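(* Let $\mathcal{A}_E={\rm Comb}_E(\mathcal{A}_i)_{i\in I}$ be the $E$-combination of a family $(\mathcal{A}_i)_{i\in I}$ of relational structures. If the language $\bigcup_{i\in I}\Sigma(\mathcal{A}_i)$ is at most countable and the structure $\mathcal{A}_E$ is infinite, then the theory $T={\rm Th}(\mathcal{A}_E)$ is Ehrenfeucht if and only if $e\text{-}{\rm Sp}(T)<\omega$ (which is equivalent here to $e\text{-}{\rm Sp}(T)=0$, i.e. the characterization also holds with $e\text{-}{\rm Sp}(T)<\omega$ replaced by $e\text{-}{\rm Sp}(T)=0$) and for an $e$-largest model $\mathcal{A}_{E'}\models T$, consisting of $E'$-classes $\mathcal{A}_j$, $j\in J$, the following conditions hold: (a) for any $j\in J$, $I({\rm Th}(\mathcal{A}_j),\omega)<\omega$; (b) the number of $j\in J$ such that $I({\rm Th}(\mathcal{A}_j),\omega)>1$ is positive and finite; (c) if $I({\rm Th}(\mathcal{A}_j),\omega)\leq 1$ then there are always finitely many $\mathcal{A}_{j'}\equiv\mathcal{A}_j$ or always infinitely many $\mathcal{A}_{j'}\equiv\mathcal{A}_j$, independently of the choice of the model $\mathcal{A}_{E'}\models T$.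
   Context: All languages are relational. Given a family $(\mathcal{A}_i)_{i\in I}$ of (nonempty, pairwise disjoint) structures, where symbols missing from a language are interpreted by empty relations so that all languages may be taken to coincide, the $E$-combination $\mathcal{A}_E={\rm Comb}_E(\mathcal{A}_i)_{i\in I}$ is the disjoint union of the $\mathcal{A}_i$ (each relation symbol interpreted by the union of its interpretations) expanded by a new binary symbol $E$, interpreted as the equivalence relation whose classes are exactly the universes of the $\mathcal{A}_i$. Every $\mathcal{A}'\equiv\mathcal{A}_E$ is again an $E$-combination, of its restrictions to its equivalence classes; equivalence classes are identified with the structures on them. In a model $\mathcal{A}_{E'}$ of ${\rm Th}(\mathcal{A}_E)$, $E'$ denotes the interpretation of the equivalence relation symbol. For $\mathcal{A}'\equiv\mathcal{A}_E$, $e\text{-}{\rm Sp}(\mathcal{A}')$ is the number of pairwise elementarily non-equivalent structures $\mathcal{B}$ such that $\mathcal{B}$ is the restriction of some $\mathcal{A}''\equiv\mathcal{A}'$ to one of its equivalence classes and $\mathcal{B}$ is not elementarily equivalent to the restriction of $\mathcal{A}'$ to any of its equivalence classes. Then $e\text{-}{\rm Sp}({\rm Th}(\mathcal{A}_E))=\sup\{e\text{-}{\rm Sp}(\mathcal{A}')\mid\mathcal{A}'\equiv\mathcal{A}_E\}$. A model $\mathcal{A}'$ of ${\rm Th}(\mathcal{A}_E)$ is $e$-largest if every restriction of a model of ${\rm Th}(\mathcal{A}_E)$ to one of its equivalence classes is elementarily equivalent to the restriction of $\mathcal{A}'$ to some of its equivalence classes, that is, $e\text{-}{\rm Sp}(\mathcal{A}')=0$.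 $I(T,\lambda)$ denotes the number of pairwise non-isomorphic models of $T$ of cardinality $\lambda$. A theory $T$ is Ehrenfeucht if $1<I(T,\omega)<\omega$. *)

(* Defs.v *)
From mathcomp Require Import all_boot.
From mathcomp Require Import boolp classical_sets functions cardinality.

Set Implicit Arguments.
Unset Strict Implicit.
Unset Printing Implicit Defensive.

Local Open Scope classical_set_scope.

(* Arities are positive: with a nullary symbol, a structure could not be
   recovered as the restriction of a disjoint union. *)
Record language := Language {
  symbol :> Type;
  arity : symbol -> nat;
  arity_gt0 : forall r, (0 < arity r)%N }.

(* Well-scoped first-order formulas with equality: [formula L n] has its free
   variables in 'I_n, and [FAll] binds the variable 0. *)
Inductive formula (L : language) : nat -> Type :=
| FEq n : 'I_n -> 'I_n -> formula L n
| FRel n (r : L) : (arity r).-tuple 'I_n -> formula L n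
| FBot n : formula L n
| FImp n : formula L n -> formula L n -> formula L n
| FAll n : formula L n.+1 -> formula L n.

Notation sentence L := (formula L 0).

(* Empty carriers are allowed here; nonemptiness is a hypothesis where needed,
   and is preserved by elementary equivalence. *)
Record structure (L : language) := Structure {
  carrier :> Type;
  interp : forall r : L, (arity r).-tuple carrier -> Prop }.

Section Semantics.
Variable L : language.
Implicit Types M N : structure L.

Fixpoint sat M n (phi : formula L n) : n.-tuple M -> Prop :=
  match phi in formula _ n return n.-tuple M -> Prop with
  | FEq _ i j => fun v => tnth v i = tnth v j
  | FRel _ r t => fun v => interp (map_tuple (tnth v) t)
  | FBot _ => fun=> False
  | FImp _ p q => fun v => sat p v -> sat q v
  | FAll _ p => fun v => forall x : M, sat p (cons_tuple x v)
  end.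

Definition holds M (phi : sentence L) : Prop := sat phi ([tuple] : 0.-tuple M).

Definition Th M : set (sentence L) := [set phi | holds M phi].

Definition models M (T : set (sentence L)) : Prop :=
  forall phi, T phi -> holds M phi.

Definition elem_equiv M N : Prop := Th M = Th N.

Definition iso M N : Prop :=
  exists f : M -> N, bijective f /\
    forall (r : L) (t : (arity r).-tuple M),
      interp t <-> interp (map_tuple f t).

End Semantics.

(* [num_ge P R n]: among the elements satisfying P there are at least n that
   are pairwise not related by R. *)
Definition num_ge (X : Type) (P : X -> Prop) (R : X -> X -> Prop) (n : nat) :=
  exists f : 'I_n -> X,
    (forall i, P (f i)) /\ (forall i j, i != j -> ~ R (f i) (f j)).

Definition num_le (X : Type) (P : X -> Prop) (R : X -> X -> Prop) (n : nat) :=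
  ~ num_ge P R n.+1.

Definition num_lt_omega (X : Type) (P : X -> Prop) (R : X -> X -> Prop) :=
  exists n, num_le P R n.

Section CountableModels.
Variables (L : language) (T : set (sentence L)).

Definition omega_model (M : structure L) : Prop :=
  models M T /\ ([set: M] #= [set: nat])%card.

(* I(T, omega) >= n, I(T, omega) <= n and I(T, omega) < omega *)
Definition I_ge (n : nat) := num_ge omega_model (@iso L) n.
Definition I_le (n : nat) := num_le omega_model (@iso L) n.
Definition I_lt_omega := num_lt_omega omega_model (@iso L).

Definition Ehrenfeucht := I_ge 2 /\ I_lt_omega.

End CountableModels.

Section WithE.
Variable L : language.

Definition arityE (r : option L) : nat := if r is Some s then arity s else 2.

Lemma arityE_gt0 r : (0 < arityE r)%N.
Proof. by case: r => [s|] //=; exact: arity_gt0. Qed.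

(* L expanded by a new binary symbol E, encoded as [None] *)
Definition withE : language := Language arityE_gt0.

Definition Erel (M : structure withE) (x y : M) : Prop :=
  @interp withE M None [tuple x; y].

(* When E is an equivalence relation on M, this is the restriction of M to the
   E-class of a, with E forgotten; classes are thus represented by their
   elements, and counted by counting elements up to E. *)
Definition eclass (M : structure withE) (a : M) : structure L :=
  @Structure L {x : M | Erel a x}
    (fun r t => @interp withE M (Some r) (map_tuple (@sval M _) t)).

Section Comb.
Variables (I : Type) (A : I -> structure L).

Definition comb_interp (r : withE) :
    (arity r).-tuple {i : I & A i} -> Prop :=
  match r return (arityE r).-tuple {i : I & A i} -> Prop with
  | None => fun t => projT1 (tnth t ord0) = projT1 (tnth t ord_max)
  | Some s => fun t => exists (i : I) (u : (arity s).-tuple (A i)),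
      t = map_tuple (existT (fun j => carrier (A j)) i) u /\ interp u
  end.

Definition CombE : structure withE := @Structure withE {i : I & A i} comb_interp.

End Comb.

(* The structures counted by e-Sp(M) *)
Definition new_class (M : structure withE) (B : structure L) : Prop :=
  (exists N : structure withE, elem_equiv N M /\ exists b : N, B = eclass b) /\
  (forall a : M, ~ elem_equiv B (eclass a)).

(* e-Sp(M) <= n *)
Definition eSp_le (M : structure withE) (n : nat) :=
  num_le (new_class M) (@elem_equiv L) n.

Section Theory.
Variable T : set (sentence withE).

(* e-Sp(T) <= n, where e-Sp(T) is the supremum of e-Sp(M) for M a model of T *)
Definition eSpT_le (n : nat) := forall M, models M T -> eSp_le M n.
Definition eSpT_lt_omega := exists n, eSpT_le n.
Definition eSpT_eq0 := eSpT_le 0.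

Definition e_largest (M : structure withE) : Prop :=
  models M T /\
  forall N : structure withE, models N T ->
    forall b : N, exists a : M, elem_equiv (eclass b) (eclass a).

(* M has finitely many E-classes elementarily equivalent to B *)
Definition fin_classes_equiv (M : structure withE) (B : structure L) :=
  num_lt_omega (fun b : M => elem_equiv (eclass b) B) (@Erel M).

Definition cond_a (M : structure withE) :=
  forall a : M, I_lt_omega (Th (eclass a)).

Definition cond_b (M : structure withE) :=
  let P := fun a : M => I_ge (Th (eclass a)) 2 in
  num_ge P (@Erel M) 1 /\ num_lt_omega P (@Erel M).

Definition cond_c (M : structure withE) :=
  forall a : M, I_le (Th (eclass a)) 1 ->
    (forall N, models N T -> fin_classes_equiv N (eclass a)) \/
    (forall N, models N T -> ~ fin_classes_equiv N (eclass a)).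

(* Every theory of an E-combination has e-largest models. The conditions are
   required of all of them: if some class theory with more than one countable
   model occurs as a limit of other class theories, condition (b) can hold in
   one e-largest model and fail in another. *)
Definition e_largest_cond :=
  forall M, e_largest M -> [/\ cond_a M, cond_b M & cond_c M].

End Theory.
End WithE.

(* Main.v *)
Require Import Defs.
From Stdlib Require List.
From mathcomp Require Import all_boot.
From mathcomp Require Import boolp classical_sets functions cardinality filter.

Set Implicit Arguments.
Unset Strict Implicit.
Unset Printing Implicit Defensive.

Local Open Scope classical_set_scope.

(** Call profile of a combination the number of classes satisfying each sentence
    of L, all infinite numbers being identified.  The profile and the theory of
    a combination determine each other ([comb_equiv_profile] and
    [profile_comb_equiv], by Ehrenfeucht-Fraisse games).  Hence a structure X
    such that every sentence true in X holds in infinitely many classes, a limit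
    of the classes, can be added to a model of T as a new class, any number of
    times, without changing the theory; and a class theory that occurs in one
    model of T and not in another is a limit of the classes of the latter
    ([missing_class_limit]).

    Suppose that infinitely many theories occur among the classes.  A suitable
    ultraproduct of the classes is a limit X, and deleting the classes
    elementarily equivalent to X gives a model M of T that omits Th(X)
    ([infinitely_many_theories_limit]).  Then T is not Ehrenfeucht: start from a
    countable model that omits Th(X) and add k copies of a countable model of
    Th(X), for k = 0, 1, 2 and so on ([limit_many_models]).  The conditions on
    e-largest models fail as well.  Add infinitely many copies of X to an
    e-largest model; if Th(X) has several countable models, the result
    contradicts (b), and otherwise it contradicts (c), because M has no class
    elementarily equivalent to X ([conditions_finitely_many_theories]).

    So both sides of the equivalence imply that only finitely many theories
    occur.  Each of them is then isolated by a sentence among the classes, and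
    all models of T have the same class theories with the same multiplicities
    ([theory_counts]).  In particular e-Sp(T) = 0, every model is e-largest and
    (c) holds.  What remains is to count countable models, which are determined
    by the number of their classes in each isomorphism type.  If the theory of
    a class has n countable models, using one of them for all classes of that
    theory gives n pairwise non-isomorphic countable models of T
    ([class_many_models]).  If a theory
    with two countable models C and C' occurs infinitely often, C is a limit of
    a model in which all classes of this theory are copies of C', so there are
    again infinitely many countable models.  Conversely, under (a) and (b) the
    isomorphism type is free for boundedly many classes only, each of which has
    finitely many possibilities ([finitely_many_models]). *)

(** * Connectives and elementary equivalence *)

Section Connectives.
Variable L : language.
Implicit Types M N : structure L.

Definition fnot n (p : formula L n) := FImp p (FBot L n).
Definition fand n (p q : formula L n) := fnot (FImp p (fnot q)).
Definition fex n (p : formula L n.+1) := fnot (FAll (fnot p)).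

Definition fconj n (s : seq (formula L n)) := foldr (@fand n) (fnot (FBot L n)) s.

Fixpoint fexs n : formula L n -> sentence L :=
  match n with 0 => id | n'.+1 => fun p => fexs (fex p) end.

Lemma sat_not M n (p : formula L n) (v : n.-tuple M) :
  sat (fnot p) v <-> ~ sat p v.
Proof. by []. Qed.

Lemma sat_and M n (p q : formula L n) (v : n.-tuple M) :
  sat (fand p q) v <-> sat p v /\ sat q v.
Proof.
split=> [H|[Hp Hq] H]; last by exact: (H Hp Hq).
by apply: contrapT => nH; apply: H => Hp Hq; apply: nH.
Qed.

Lemma sat_ex M n (p : formula L n.+1) (v : n.-tuple M) :
  sat (fex p) v <-> exists x, sat p (cons_tuple x v).
Proof.
split=> [H|[x Hx] H]; last by exact: (H x Hx).
by apply: contrapT => nH; apply: H => x Hx; apply: nH; exists x.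
Qed.

Lemma sat_conj M n (s : seq (formula L n)) (v : n.-tuple M) :
  sat (fconj s) v <-> forall p, List.In p s -> sat p v.
Proof.
elim: s => [|p s IH]; first by split=> // _ [].
rewrite -[fconj _]/(fand p (fconj s)) sat_and IH; split=> [[Hp Hs] q [<-|/Hs]//|H].
by split=> [|q Hq]; apply: H; [left|right].
Qed.

Lemma holds_and M (p q : sentence L) : holds M (fand p q) <-> holds M p /\ holds M q.
Proof. exact: sat_and. Qed.

Lemma holds_conj M (s : seq (sentence L)) :
  holds M (fconj s) <-> forall p, List.In p s -> holds M p.
Proof. exact: sat_conj. Qed.

Lemma holds_exs M n (p : formula L n) :
  holds M (fexs p) <-> exists v : n.-tuple M, sat p v.
Proof.
elim: n p => [|n IH] p /=.
  by split=> [H|[v]]; [exists [tuple]|rewrite tuple0].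
rewrite IH; split=> [[v /sat_ex[x Hx]]|[v Hv]]; first by exists (cons_tuple x v).
by case/tupleP: v Hv => x w Hv; exists w; apply/sat_ex; exists x.
Qed.

Lemma elem_equivP M N :
  elem_equiv M N <-> forall p : sentence L, holds M p -> holds N p.
Proof.
split=> [E p|H]; first by rewrite -[holds M p]/(Th M p) E.
apply/seteqP; split=> p Hp; first exact: H.
by apply: contrapT => nHp; exact: (H (fnot p)).
Qed.

Lemma models_elem_equiv M N : models M (Th N) <-> elem_equiv N M.
Proof. by rewrite elem_equivP. Qed.

Lemma elem_equiv_sym M N : elem_equiv M N -> elem_equiv N M.
Proof. by move=> E; rewrite /elem_equiv -E. Qed.

Lemma elem_equiv_trans M N K : elem_equiv M N -> elem_equiv N K -> elem_equiv M K.
Proof. by rewrite /elem_equiv => ->. Qed.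

Lemma not_elem_equiv M N : ~ elem_equiv M N ->
  exists p : sentence L, holds M p /\ ~ holds N p.
Proof.
move=> H; apply: contrapT => nH; apply: H; apply/elem_equivP => p Mp.
by apply: contrapT => Np; apply: nH; exists p.
Qed.

End Connectives.

(** * Back-and-forth systems *)

Section BackAndForth.
Variable L : language.
Implicit Types M N : structure L.

Fixpoint symbols n (p : formula L n) : seq L :=
  match p with
  | FEq _ _ _ => [::] | FRel _ r _ => [:: r] | FBot _ => [::]
  | FImp _ p q => symbols p ++ symbols q
  | FAll _ p => symbols p
  end.

Fixpoint rank n (p : formula L n) : nat :=
  match p with
  | FEq _ _ _ => 0 | FRel _ _ _ => 0 | FBot _ => 0
  | FImp _ p q => maxn (rank p) (rank q)
  | FAll _ p => (rank p).+1
  end.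

Definition agree M N n (s : seq (formula L n)) (v : n.-tuple M) (w : n.-tuple N) :=
  forall p, List.In p s -> (sat p v <-> sat p w).

Definition atoms (S : seq L) n : seq (formula L n) :=
  [seq FEq L ij.1 ij.2 | ij <- enum {: 'I_n * 'I_n}] ++
  flatten [seq [seq FRel t | t <- enum {: (arity r).-tuple 'I_n}] | r <- S].

(** Every tuple satisfies exactly one of these complete descriptions, and it
    decides which formulas of the list hold. *)
Fixpoint complete_conjs n (s : seq (formula L n)) : seq (formula L n) :=
  if s is p :: s' then
    [seq fand p c | c <- complete_conjs s'] ++
    [seq fand (fnot p) c | c <- complete_conjs s']
  else [:: fnot (FBot L n)].

(** Finitely many formulas of rank at most [q] over the symbols [S], such that
    two tuples agreeing on them are indistinguishable in the
    Ehrenfeucht-Fraisse game of length [q].  The successor step quantifies over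
    every complete description of the extended tuple. *)
Fixpoint types (S : seq L) (q n : nat) : seq (formula L n) :=
  if q is q'.+1 then
    atoms S n ++ [seq fex c | c <- complete_conjs (types S q' n.+1)]
  else atoms S n.

Lemma agree_sym M N n (s : seq (formula L n)) (v : n.-tuple M) (w : n.-tuple N) :
  agree s v w -> agree s w v.
Proof. by move=> H p /H->. Qed.

Lemma In_cat T (x : T) s1 s2 :
  List.In x (s1 ++ s2) <-> List.In x s1 \/ List.In x s2.
Proof. exact: List.in_app_iff. Qed.

Lemma In_map T U (f : T -> U) s y :
  List.In y (map f s) <-> exists x, f x = y /\ List.In x s.
Proof. exact: List.in_map_iff. Qed.

Lemma In_mem (T : eqType) (x : T) s : List.In x s <-> x \in s.
Proof.
elim: s => //= y s IH; rewrite inE; split=> [[->|/IH->]|/orP[/eqP->|/IH]].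
- by rewrite eqxx.
- by rewrite orbT.
- by left.
- by right.
Qed.

Lemma In_flatten T (x : T) ss :
  List.In x (flatten ss) <-> exists s, List.In s ss /\ List.In x s.
Proof.
elim: ss => [|s ss IH] /=; first by split=> // -[s []].
rewrite In_cat IH; split=> [[H|[t [H1 H2]]]|[t [[<-|H1] H2]]].
- by exists s; split; [left|].
- by exists t; split; [right|].
- by left.
- by right; exists t.
Qed.

Lemma agree_cat M N n (s1 s2 : seq (formula L n)) (v : n.-tuple M) (w : n.-tuple N) :
  agree (s1 ++ s2) v w <-> agree s1 v w /\ agree s2 v w.
Proof.
split=> [H|[H1 H2] p /In_cat[/H1|/H2]//].
by split=> p Hp; apply: H; apply/In_cat; [left|right].
Qed.

Lemma agree_atoms M N S n (v : n.-tuple M) (w : n.-tuple N) :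
  agree (atoms S n) v w <->
  (forall i j, tnth v i = tnth v j <-> tnth w i = tnth w j) /\
  (forall r (t : (arity r).-tuple 'I_n), List.In r S ->
     interp (map_tuple (tnth v) t) <-> interp (map_tuple (tnth w) t)).
Proof.
rewrite agree_cat; split=> -[H1 H2]; split.
- move=> i j; apply: (H1 (FEq L i j)); apply/In_map; exists (i, j); split=> //.
  by apply/In_mem; rewrite mem_enum.
- move=> r t Hr; apply: (H2 (FRel t)); apply/In_flatten.
  exists [seq FRel t | t <- enum {: (arity r).-tuple 'I_n}]; split.
    by apply/In_map; exists r.
  by apply/In_map; exists t; split=> //; apply/In_mem; rewrite mem_enum.
- by move=> p /In_map[[i j] [<- _]]; exact: H1.
- move=> p /In_flatten[s [/In_map[r [<- Hr]] /In_map[t [<- _]]]]; exact: H2.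
Qed.

Lemma complete_conjs_real M n (s : seq (formula L n)) (v : n.-tuple M) :
  exists c, [/\ List.In c (complete_conjs s), sat c v &
    forall N (w : n.-tuple N), sat c w -> agree s v w].
Proof.
elim: s => [|p s [c [Hc cv IH]]] /=.
  by exists (fnot (FBot L n)); split=> //; left.
have [pv|npv] := pselect (sat p v).
  exists (fand p c); split; first by apply/In_cat; left; apply/In_map; exists c.
    by apply/sat_and.
  by move=> N w /sat_and[pw cw] q [<-|/(IH _ _ cw)].
exists (fand (fnot p) c); split.
- by apply/In_cat; right; apply/In_map; exists c.
- by apply/sat_and.
- move=> N w /sat_and[pw cw] q [<-|/(IH _ _ cw)//]; by split=> [/npv|/pw].
Qed.

Lemma complete_conjs_agree M N n (s : seq (formula L n)) (v : n.-tuple M) (w : n.-tuple N) c :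
  List.In c (complete_conjs s) -> agree s v w -> (sat c v <-> sat c w).
Proof.
elim: s c => [|p s IH] c /=; first by case=> // <-.
move=> cs psvw; have pvw : sat p v <-> sat p w by apply: psvw; left.
have {}IH d : List.In d (complete_conjs s) -> (sat d v <-> sat d w).
  by move=> ds; apply: IH => // q qs; apply: psvw; right.
case/In_cat: cs => /In_map[d [<- /IH dvw]].
  by rewrite !sat_and pvw dvw.
by rewrite !sat_and !sat_not pvw dvw.
Qed.

Lemma types_atoms M N S q n (v : n.-tuple M) (w : n.-tuple N) :
  agree (types S q n) v w -> agree (atoms S n) v w.
Proof. by case: q => //= q /agree_cat[]. Qed.

(** The complete description of the longer tuple, existentially quantified, is
    one of the formulas on which [v] and [w] agree, so [w] has an extension
    with the same description. *)
Lemma types_forth M N S q n (v : n.-tuple M) (w : n.-tuple N) :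
  agree (types S q.+1 n) v w ->
  forall x, exists y, agree (types S q n.+1) (cons_tuple x v) (cons_tuple y w).
Proof.
move=> /agree_cat[_ H] x.
have [c [Hc cx cN]] := complete_conjs_real (types S q n.+1) (cons_tuple x v).
have Hex : List.In (fex c) [seq fex c | c <- complete_conjs (types S q n.+1)].
  by apply/In_map; exists c.
have [y Hy] : exists y, sat c (cons_tuple y w).
  by apply/sat_ex; apply/(H _ Hex); apply/sat_ex; exists x.
by exists y; exact: cN.
Qed.

(** The index [q] counts the remaining moves, so that [Z] only has to survive as
    many moves as there are nested quantifiers. *)
Lemma back_and_forth M N S
    (Z : nat -> forall n, n.-tuple M -> n.-tuple N -> Prop) :
  (forall q n v w, Z q n v w -> agree (atoms S n) v w) ->
  (forall q n v w, Z q.+1 n v w ->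
     (forall x, exists y, Z q n.+1 (cons_tuple x v) (cons_tuple y w)) /\
     (forall y, exists x, Z q n.+1 (cons_tuple x v) (cons_tuple y w))) ->
  forall n (p : formula L n) q v w,
    (forall r, List.In r (symbols p) -> List.In r S) -> (rank p <= q)%N ->
    Z q n v w -> (sat p v <-> sat p w).
Proof.
move=> Zat Zbf n p; elim: p => {n} [n i j|n r t|n|n p IHp p' IHp'|n p IHp] q v w.
- by move=> _ _ /Zat/agree_atoms[H _]; exact: H.
- by move=> HS _ /Zat/agree_atoms[_ H]; apply: H; apply: HS; left.
- by [].
- move=> /= HS; rewrite geq_max => /andP[rp rp'] z.
  rewrite (IHp q v w) ?(IHp' q v w) // => r Hr; apply: HS; apply/In_cat;
    by [left|right].
- case: q => //= q HS; rewrite ltnS => rp /Zbf[F B].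
  split=> H x.
    by have [y z] := B x; apply/(IHp _ _ _ HS rp z).
  by have [y z] := F x; apply/(IHp _ _ _ HS rp z).
Qed.

End BackAndForth.

(** * Counting elements up to an equivalence *)

Section Counting.
Implicit Types X Y : Type.

Lemma sig_inj (T : Type) (P : T -> Prop) : injective (@sval T P).
Proof. by move=> [x Hx] [y Hy]; exact: eq_exist. Qed.

Lemma existT_inj (T : Type) (P : T -> Type) x (a b : P x) :
  existT P x a = existT P x b -> a = b.
Proof. exact: (@existT_inj2 {classic T} P). Qed.

Lemma dep_choice X (Y : X -> Type) (P : forall x, Y x -> Prop) :
  (forall x, exists y, P x y) -> exists f : forall x, Y x, forall x, P x (f x).
Proof. by move=> H; exists (fun x => projT1 (cid (H x))) => x; exact: projT2. Qed.

Lemma num_ge_eqP X (P : X -> Prop) n :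
  num_ge P eq n <-> exists f : 'I_n -> X, injective f /\ forall i, P (f i).
Proof.
split=> -[f [H1 H2]]; exists f; split=> //.
  by move=> i j fij; apply: contrapT => /eqP/H2.
by move=> i j /eqP ij /H1.
Qed.

Lemma num_ge0 X (P : X -> Prop) R : num_ge P R 0.
Proof.
have f : 'I_0 -> X by case.
by exists f; split=> -[].
Qed.

Lemma num_ge_leq X (P : X -> Prop) R m n : (m <= n)%N -> num_ge P R n -> num_ge P R m.
Proof.
move=> mn [f [Pf Rf]]; exists (f \o widen_ord mn); split=> [i|i j ij]; first exact: Pf.
by apply: Rf; apply: contra ij => /eqP/(congr1 val)/= e; apply/eqP/val_inj.
Qed.

Lemma num_ge_map X Y (h : X -> Y) (P : X -> Prop) (Q : Y -> Prop) R R' n :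
  (forall x, P x -> Q (h x)) ->
  (forall x x', P x -> P x' -> R' (h x) (h x') -> R x x') ->
  num_ge P R n -> num_ge Q R' n.
Proof.
move=> PQ RR [f [Pf Rf]]; exists (h \o f); split=> [i|i j ij]; first exact/PQ.
by move=> /RR-/(_ (Pf i) (Pf j)); exact: Rf.
Qed.

Lemma num_ge_surj X Y (h : X -> Y) (P : X -> Prop) (Q : Y -> Prop) R R' n :
  (forall y, exists x, h x = y) ->
  (forall x, P x <-> Q (h x)) -> (forall x x', R x x' <-> R' (h x) (h x')) ->
  num_ge P R n <-> num_ge Q R' n.
Proof.
move=> /choice[g hg] PQ RR; split.
  by apply: (num_ge_map (h := h)) => [x /PQ|x x' _ _ /RR].
by apply: (num_ge_map (h := g)) => [y|y y' _ _ /RR]; rewrite ?PQ !hg.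
Qed.

Lemma num_ge_extend X (P : X -> Prop) (R : X -> X -> Prop) n (f : 'I_n -> X) x :
  (forall y z, R y z -> R z y) ->
  (forall i, P (f i)) -> (forall i j, i != j -> ~ R (f i) (f j)) ->
  P x -> (forall i, ~ R x (f i)) -> num_ge P R n.+1.
Proof.
move=> Rsym Pf Rf Px Rx; exists (fun k => if unlift ord0 k is Some k' then f k' else x).
split=> [k|k l]; first by case: unliftP.
case: unliftP => [k' ->|->]; case: unliftP => [l' ->|->].
- by rewrite (inj_eq lift_inj); exact: Rf.
- by move=> _ /Rsym; exact: Rx.
- by move=> _; exact: Rx.
- by rewrite eqxx.
Qed.

(** Used with the type of all structures for [X], which is too large to be the
    type of entries of a tuple. *)
Lemma seq_index X (s : seq X) :
  exists e : 'I_(size s) -> X, forall x, List.In x s -> exists k, e k = x.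
Proof.
elim: s => [|y s [e He]] /=.
  have e : 'I_0 -> X by case.
  by exists e.
exists (fun k => if unlift ord0 k is Some k' then e k' else y) => x [->|/He[k <-]].
  by exists ord0; rewrite unlift_none.
by exists (lift ord0 k); rewrite liftK.
Qed.

(** Pigeonhole: pairwise unrelated elements are related to different elements
    of the list. *)
Lemma cover_bound X (P : X -> Prop) (R : X -> X -> Prop) (s : seq X) n :
  (forall x y, R x y -> R y x) -> (forall x y z, R x y -> R y z -> R x z) ->
  (forall x, P x -> exists y, List.In y s /\ R x y) -> num_ge P R n -> (n <= size s)%N.
Proof.
move=> Rsym Rtr cov [f [Pf Rf]].
have [e He] := seq_index s.
have idx i : exists k : 'I_(size s), R (f i) (e k).
  by have [y [ys Ry]] := cov _ (Pf i); have [k ek] := He y ys; exists k; rewrite ek.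
have [g Hg] := choice idx.
have ginj : injective g.
  move=> i j gij; apply: contrapT => /eqP/Rf; apply; apply: Rtr (Hg i) _.
  by rewrite gij; apply: Rsym.
by have := leq_card g ginj; rewrite !card_ord.
Qed.

(** A family of unrelated elements that cannot be extended meets every class
    of [R]. *)
Lemma bounded_cover X (P : X -> Prop) (R : X -> X -> Prop) n :
  (forall x y, R x y -> R y x) -> (forall x, R x x) -> ~ num_ge P R n ->
  exists s : seq X, forall x, P x -> exists y, List.In y s /\ R x y.
Proof.
move=> Rsym Rrefl; elim: n => [[]|n IH H]; first exact: num_ge0.
have [[f [Pf Rf]]|/IH//] := pselect (num_ge P R n).
exists [seq f i | i <- enum 'I_n] => x Px; apply: contrapT => nex; apply: H.
apply: (num_ge_extend (f := f) (x := x)) => // i Ri; apply: nex; exists (f i); split=> //.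
by apply/In_map; exists i; split=> //; apply/In_mem; rewrite mem_enum.
Qed.

Lemma num_ge_max X (P : X -> Prop) R n :
  ~ num_ge P R n -> exists m, num_ge P R m /\ ~ num_ge P R m.+1.
Proof.
elim: n => [[]|n IH H]; first exact: num_ge0.
by have [?|/IH//] := pselect (num_ge P R n); exists n.
Qed.

Lemma not_num_lt_omega X (P : X -> Prop) R n : ~ num_lt_omega P R -> num_ge P R n.
Proof. by move=> H; apply: contrapT => nn; apply: H; exists n => /(num_ge_leq (leqnSn n)). Qed.

Lemma inj_surj_bij X Y (f : X -> Y) :
  injective f -> (forall y, exists x, f x = y) -> bijective f.
Proof. by move=> finj /choice[g gK]; exists g => // x; apply: finj. Qed.

Lemma countable_inj X Y (f : X -> Y) :
  injective f -> countable [set: Y] -> countable [set: X].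
Proof.
move=> finj /countable_injP[g ginj]; apply/countable_injP; exists (g \o f) => x y _ _ /= e.
by apply: finj; apply: ginj; rewrite ?inE.
Qed.

Lemma countable_surj X Y (f : X -> Y) :
  (forall y, exists x, f x = y) -> countable [set: X] -> countable [set: Y].
Proof.
move=> /choice[g gK]; apply: (countable_inj (f := g)); exact: can_inj gK.
Qed.

Lemma countable_sigT X (Y : X -> Type) : countable [set: X] ->
  (forall x, countable [set: Y x]) -> countable [set: {x : X & Y x}].
Proof.
move=> /countable_injP[f finj] HY.
have /dep_choice[g ginj] : forall x, exists g : Y x -> nat, injective g.
  by move=> x; have /countable_injP[g gi] := HY x; exists g => y z; apply: gi; rewrite inE.
apply: (countable_inj (Y := nat * nat) (f := fun p => (f (projT1 p), g _ (projT2 p)))); last exact: countableP.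
move=> [x y] [x' y'] /= [] /finj-/(_ _ _)/[!inE]-/(_ I I) e.
by case: _ / e y' => y' /ginj ->.
Qed.

Lemma countable_sum X Y : countable [set: X] -> countable [set: Y] -> countable [set: X + Y].
Proof.
move=> /countable_injP[f finj] /countable_injP[g ginj].
apply: (countable_inj (Y := (nat + nat)%type)
  (f := fun p => match p with inl x => inl (f x) | inr y => inr (g y) end)); last exact: countableP.
by move=> [x|y] [x'|y'] //= [] => [/finj|/ginj] -> //; rewrite inE.
Qed.

End Counting.

Section Bijections.
Implicit Types X Y J : Type.

Lemma finite_cover X : finite_set [set: X] -> exists s : seq X, forall x, List.In x s.
Proof.
move=> /(@finite_seqP {classic X})[s sX]; exists s => x.
by apply/(@In_mem {classic X}); have : [set` s] x by rewrite -sX.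
Qed.

Lemma num_ge_infinite X (P : X -> Prop) : (forall n, num_ge P eq n) -> infinite_set [set: X].
Proof.
move=> H /finite_cover[s sX].
have cov x : P x -> exists y, List.In y s /\ x = y by exists x.
by have := cover_bound (@esym _) (@etrans _) cov (H (size s).+1); rewrite ltnn.
Qed.

Lemma countable_infinite_bij X : countable [set: X] -> infinite_set [set: X] ->
  exists f : X -> nat, bijective f.
Proof.
move=> Xc Xi; have /pcard_eqP[f] := eq_card_nat Xc Xi.
by exists f; rewrite -setTT_bijective.
Qed.

Lemma num_ge_exact_bij X n : num_ge (fun _ : X => True) eq n ->
  ~ num_ge (fun _ : X => True) eq n.+1 -> exists f : 'I_n -> X, bijective f.
Proof.
move=> /num_ge_eqP[f [finj _]] nX; exists f; apply: inj_surj_bij => // x.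
apply: contrapT => nx; apply: nX; apply: (num_ge_extend (f := f) (x := x)) => //.
  by move=> i j ij /finj e; rewrite e eqxx in ij.
by move=> i e; apply: nx; exists i.
Qed.

(** Either both types are finite of the same size, or both are countably
    infinite. *)
Lemma countable_bij X Y : countable [set: X] -> countable [set: Y] ->
  (forall n, num_ge (fun _ : X => True) eq n <-> num_ge (fun _ : Y => True) eq n) ->
  exists f : X -> Y, bijective f.
Proof.
move=> Xc Yc XY; have [[n /num_ge_max[m [mX mX']]]|H] :=
  pselect (exists n, ~ num_ge (fun _ : X => True) eq n).
  have [f [f' fK f'K]] := num_ge_exact_bij mX mX'.
  move: mX mX'; rewrite !XY => mY mY'; have [g gbij] := num_ge_exact_bij mY mY'.
  by exists (g \o f'); apply: bij_comp gbij _; exists f.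
have HX n : num_ge (fun _ : X => True) eq n by apply: contrapT => nX; apply: H; exists n.
have [f fbij] := countable_infinite_bij Xc (num_ge_infinite HX).
have [g [g' gK g'K]] : exists g : Y -> nat, bijective g.
  by apply: countable_infinite_bij => //; apply: num_ge_infinite => n; apply/XY.
by exists (g' \o f); apply: bij_comp fbij; exists g.
Qed.

Lemma num_ge_sig X (P : X -> Prop) n :
  num_ge (fun _ : {x | P x} => True) eq n <-> num_ge P eq n.
Proof.
split; first by apply: (num_ge_map (h := sval)) => [[]//|x y _ _]; exact: sig_inj.
move=> /num_ge_eqP[f [finj Pf]]; apply/num_ge_eqP; exists (fun i => exist _ _ (Pf i)).
by split=> // i j [] /finj.
Qed.

(** Corresponding fibres of [f] and [f'] over a class of [R] are in bijection,
    and these bijections are glued together. *)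
Lemma bijection_of_counts X J J' (R : X -> X -> Prop) (f : J -> X) (f' : J' -> X) :
  (forall x, R x x) -> (forall x y, R x y -> R y x) ->
  (forall x y z, R x y -> R y z -> R x z) ->
  countable [set: J] -> countable [set: J'] ->
  (forall x n, num_ge (fun j => R x (f j)) eq n <-> num_ge (fun j => R x (f' j)) eq n) ->
  exists s : J -> J', bijective s /\ forall j, R (f j) (f' (s j)).
Proof.
move=> Rrefl Rsym Rtrans Jc J'c H.
(* The bijection between two fibres has to depend on the class of [R] only,
   hence the choice is made over the quotient [K] of [X]. *)
pose K := {C : X -> Prop | exists x, C = R x}.
pose F (C : K) := {j | sval C (f j)}; pose F' (C : K) := {j | sval C (f' j)}.
have /dep_choice[g gbij] : forall C : K, exists g : F C -> F' C, bijective g.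
  move=> C; apply: countable_bij => [||n].
  - by apply: countable_inj Jc; exact: sig_inj.
  - by apply: countable_inj J'c; exact: sig_inj.
  - by rewrite !num_ge_sig; have [x ->] := svalP C; exact: H.
pose key x : K := exist _ (R x) (ex_intro _ x erefl).
have keyE x (C : K) : sval C x -> key x = C.
  move=> Cx; apply: sig_inj; have [z Cz] := svalP C; rewrite /= Cz in Cx *.
  apply: functional_extensionality_dep => y; apply: propext.
  by split; apply: Rtrans => //; exact: Rsym.
pose s j : J' := sval (g (key (f j)) (exist _ j (Rrefl (f j)))).
have sE (C : K) (p : F C) : s (sval p) = sval (g C p).
  case: p => j Cj /=; have e := keyE _ _ Cj; case: _ / e Cj => Cj; rewrite /s.
  by congr (sval (g _ _)); exact: sig_inj.
have sR j : R (f j) (f' (s j)).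
  exact: (projT2 (g (key (f j)) (exist _ j (Rrefl (f j))))).
exists s; split=> //; apply: inj_surj_bij => [j j' ss|k].
  have jj' : R (f j) (f j') by apply: Rtrans (sR j) _; rewrite ss; apply: Rsym; exact: sR.
  pose p : F (key (f j)) := exist _ j (Rrefl (f j)).
  pose p' : F (key (f j)) := exist _ j' jj'.
  have : g _ p = g _ p' by apply: sig_inj; rewrite -!sE.
  by move=> /(bij_inj (gbij _)) [].
have [h hK h'K] := gbij (key (f' k)).
exists (sval (h (exist _ k (Rrefl (f' k))))).
by rewrite sE h'K.
Qed.

End Bijections.

(** * Isomorphisms *)

Section Isomorphisms.
Variable L : language.
Implicit Types M N : structure L.

Lemma map_tnth_map (T U : Type) (f : T -> U) n m (v : n.-tuple T) (t : m.-tuple 'I_n) :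
  map_tuple (tnth (map_tuple f v)) t = map_tuple f (map_tuple (tnth v) t).
Proof. by apply: eq_from_tnth => i; rewrite !tnth_map. Qed.

Lemma map_tuple_comp (T U V : Type) (f : T -> U) (g : U -> V) n (v : n.-tuple T) :
  map_tuple g (map_tuple f v) = map_tuple (g \o f) v.
Proof. by apply: eq_from_tnth => i; rewrite !tnth_map. Qed.

Lemma eq_map_tuple (T U : Type) (f g : T -> U) n (v : n.-tuple T) :
  f =1 g -> map_tuple f v = map_tuple g v.
Proof. by move=> fg; apply: eq_from_tnth => i; rewrite !tnth_map fg. Qed.

Lemma map_cons_tuple (T U : Type) (f : T -> U) n x (v : n.-tuple T) :
  map_tuple f (cons_tuple x v) = cons_tuple (f x) (map_tuple f v).
Proof. exact: val_inj. Qed.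

Lemma iso_sat M N (f : M -> N) : bijective f ->
  (forall r (t : (arity r).-tuple M), interp t <-> interp (map_tuple f t)) ->
  forall n (p : formula L n) v, sat p v <-> sat p (map_tuple f v).
Proof.
move=> fbij fint n p; elim: p => {n} [n i j|n r t|n|n p IHp q IHq|n p IHp] v //=.
- by rewrite !tnth_map; split=> [->|/(bij_inj fbij)].
- by rewrite map_tnth_map -fint.
- by rewrite IHp IHq.
- case: fbij => g gK fK; split=> H x.
    by rewrite -(fK x) -map_cons_tuple -IHp.
  by rewrite IHp map_cons_tuple.
Qed.

Lemma iso_refl M : iso M M.
Proof.
exists id; split=> [|r t]; first by exists id.
by rewrite [map_tuple _ _](_ : _ = t) //; apply: eq_from_tnth => i; rewrite tnth_map.
Qed.

Lemma iso_sym M N : iso M N -> iso N M.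
Proof.
move=> [f [[g gK fK] H]]; exists g; split=> [|r t]; first by exists f.
rewrite [X in _ <-> X]H map_tuple_comp [map_tuple _ _](_ : _ = t) //.
by apply: eq_from_tnth => i; rewrite tnth_map /= fK.
Qed.

Lemma iso_trans M N K : iso M N -> iso N K -> iso M K.
Proof.
move=> [f [fb Hf]] [g [gb Hg]]; exists (g \o f); split=> [|r t]; first exact: bij_comp.
by rewrite Hf Hg map_tuple_comp.
Qed.

Lemma iso_elem_equiv M N : iso M N -> elem_equiv M N.
Proof.
move=> [f [fb Hf]]; apply/elem_equivP => p.
by move=> /(iso_sat fb Hf); rewrite [map_tuple _ _]tuple0.
Qed.

End Isomorphisms.

(** * Combinations and their classes *)

Section Combinations.
Variable L : language.

Lemma tuple_existT (T : Type) (P : T -> Type) x n (t : n.-tuple {x & P x}) :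
  (forall k, projT1 (tnth t k) = x) -> exists u, t = map_tuple (existT P x) u.
Proof.
move=> H; have /choice[y Hy] : forall k, exists y, tnth t k = existT P x y.
  by move=> k; case: (tnth t k) (H k) => x' y /= <-; exists y.
by exists (mktuple y); apply: eq_from_tnth => k; rewrite tnth_map tnth_mktuple.
Qed.

Section Family.
Variables (I : Type) (A : I -> structure L).
Local Notation inj := (existT (fun i => carrier (A i))).

(** The positive arity of [r] is what makes the index [i] recoverable from a
    tuple of the combination. *)
Lemma comb_interpE (r : L) i (u : (arity r).-tuple (A i)) :
  @interp _ (CombE A) (Some r) (map_tuple (inj i) u) <-> interp u.
Proof.
split=> [[i' [u' [e iu']]]|iu]; last by exists i, u.
have ii' : i = i'.
  have := congr1 (fun t => projT1 (tnth t (Ordinal (arity_gt0 r)))) e.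
  by rewrite !tnth_map.
case: _ / ii' u' iu' e => u' iu' e.
suff -> : u = u' by [].
apply: eq_from_tnth => k; have := congr1 (fun t => tnth t k) e; rewrite !tnth_map.
exact: existT_inj.
Qed.

Lemma Erel_combE (x y : CombE A) : Erel x y <-> projT1 x = projT1 y.
Proof. by rewrite /Erel /=. Qed.

End Family.

Lemma tuple2_map (M : structure (withE L)) n (v : n.-tuple M) (i j : 'I_n) :
  @interp _ M None (map_tuple (tnth v) [tuple i; j]) <-> Erel (tnth v i) (tnth v j).
Proof. by rewrite /Erel [map_tuple _ _](_ : _ = [tuple tnth v i; tnth v j]) //; exact: val_inj. Qed.

(** [M] is a combination of the [B j] up to isomorphism; only the quotient map
    [c] by E is recorded, so that counting classes of [M] becomes counting
    indices. *)
Definition class_map (J : Type) (B : J -> structure L) (M : structure (withE L))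
    (c : M -> J) :=
  [/\ forall j, exists a, c a = j, forall a b, Erel a b <-> c a = c b &
      forall a, iso (eclass a) (B (c a))].

Lemma iso_class_map J (B : J -> structure L) (M : structure (withE L)) :
  (forall j, inhabited (B j)) -> iso (CombE B) M -> exists c, @class_map J B M c.
Proof.
move=> Bne [f [[g gK fK] fint]].
have fE x y : Erel (f x) (f y) <-> projT1 x = projT1 y.
  rewrite -Erel_combE /Erel (fint None) [map_tuple _ _](_ : _ = [tuple f x; f y]) //.
  exact: val_inj.
exists (fun a => projT1 (g a)); split=> [j|a b|a].
- by have [x] := Bne j; exists (f (existT _ j x)); rewrite gK.
- by rewrite -{1}(fK a) -{1}(fK b) fE.
- apply: iso_sym; set j := projT1 (g a).
  have Ej (y : B j) : Erel a (f (existT _ j y)) by rewrite -{1}(fK a) fE.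
  exists (fun y => exist _ _ (Ej y)); split.
    apply: inj_surj_bij => [y y' []|[b Eb]].
      by move=> /(can_inj gK) e; exact: existT_inj e.
    have : projT1 (g b) = j by apply/esym/fE; rewrite !fK.
    case e: (g b) => [j' y] /= jj'; case: _ / (esym jj') y e => y e; exists y.
    by apply: eq_exist => /=; rewrite -e.
  move=> r t; rewrite -comb_interpE (fint (Some r)) /= !map_tuple_comp.
  by [].
Qed.

Lemma comb_iso I J (A : I -> structure L) (B : J -> structure L) (s : I -> J) :
  bijective s -> (forall i, iso (A i) (B (s i))) -> iso (CombE A) (CombE B).
Proof.
move=> [s' sK s'K] /dep_choice[h Hh].
exists (fun x => existT (fun j => carrier (B j)) (s (projT1 x)) (h _ (projT2 x))); split.
  apply: inj_surj_bij => [[i x] [i' x']|[j y]] /=.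
    move=> e; have /(can_inj sK) ii' := congr1 (@projT1 _ _) e.
    case: _ / ii' x' e => x' e; rewrite (bij_inj (Hh i).1 (existT_inj e)).
    by [].
  rewrite -(s'K j) in y *; have [[g gK hK] _] := Hh (s' j).
  by exists (existT _ (s' j) (g y)); rewrite /= hK.
move=> [r|] t /=.
  split=> -[i [u [e iu]]].
    exists (s i), (map_tuple (h i) u); split; last exact/(Hh i).2.
    by rewrite e; apply: eq_from_tnth => k; rewrite !tnth_map.
  have [u' e'] : exists u', t = map_tuple (existT (fun i => carrier (A i)) (s' i)) u'.
    apply: (@tuple_existT I (fun i => carrier (A i)) (s' i) (arity r) t) => k.
    have := congr1 (fun t => projT1 (tnth t k)) e.
    by rewrite !tnth_map /= => <-; rewrite sK.
  exists (s' i), u'; split=> //; apply/(Hh _).2; apply/comb_interpE.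
  exists i, u; split=> //; rewrite -e e'.
  by apply: eq_from_tnth => k; rewrite !tnth_map.
rewrite !tnth_map /=; split=> [->//|]; exact: can_inj sK _ _.
Qed.

(** An isomorphism preserves E, hence permutes the classes. *)
Lemma iso_comb I J (A : I -> structure L) (B : J -> structure L) :
  (forall i, inhabited (A i)) -> (forall j, inhabited (B j)) ->
  iso (CombE A) (CombE B) ->
  exists s : I -> J, bijective s /\ forall i, iso (A i) (B (s i)).
Proof.
move=> Ane Bne /(iso_class_map Ane)[c [csurj cE ciso]].
have [d [dsurj dE diso]] := iso_class_map Bne (iso_refl (CombE B)).
have [g gc] := choice csurj.
exists (d \o g); split.
  apply: inj_surj_bij => [i i' /= /dE/cE|j]; first by rewrite !gc.
  have [b bj] := dsurj j; exists (c b) => /=; rewrite -bj; apply/dE/cE.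
  by rewrite gc.
move=> i /=; rewrite -{1}(gc i); apply: iso_trans (diso _).
exact/iso_sym/ciso.
Qed.

Definition count_ge I (A : I -> structure L) (Q : structure L -> Prop) n :=
  num_ge (fun i => Q (A i)) eq n.

Lemma count_ge_iso_comb I J (A : I -> structure L) (B : J -> structure L)
    (P : structure L -> Prop) n :
  (forall i, inhabited (A i)) -> (forall j, inhabited (B j)) ->
  (forall X Y, iso X Y -> P X -> P Y) ->
  iso (CombE A) (CombE B) ->
  count_ge A P n -> count_ge B P n.
Proof.
move=> Ane Bne HP /(iso_comb Ane Bne)[s [sb si]].
apply: (num_ge_map (h := s)) => [i|i i' _ _ /(bij_inj sb)//]; exact: HP.
Qed.

Lemma valid_transfer (M N : structure (withE L)) n (p : formula (withE L) n) :
  elem_equiv M N -> (forall v : n.-tuple M, sat p v) -> forall v : n.-tuple N, sat p v.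
Proof.
move=> /elem_equiv_sym/elem_equivP E H v; apply: contrapT => nv.
have /E/holds_exs[w] : holds N (fexs (fnot p)) by apply/holds_exs; exists v.
by apply; exact: H.
Qed.

Definition fE n (i j : 'I_n) : formula (withE L) n := @FRel (withE L) n None [tuple i; j].

Lemma sat_fE (M : structure (withE L)) n (i j : 'I_n) (v : n.-tuple M) :
  sat (fE i j) v <-> Erel (tnth v i) (tnth v j).
Proof. exact: tuple2_map. Qed.

Lemma sat_imp (K : language) (M : structure K) n (p q : formula K n) (v : n.-tuple M) :
  sat (FImp p q) v <-> (sat p v -> sat q v).
Proof. by []. Qed.

(** That E is an equivalence relation and that related elements are E-equivalent
    is expressed by sentences of the theory.  The index type of the
    combination is the set of E-classes of [M]. *)
Lemma model_presentation I (A : I -> structure L) (M : structure (withE L)) :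
  elem_equiv (CombE A) M ->
  exists (J : Type) (B : J -> structure L),
    [/\ forall j, inhabited (B j), iso (CombE B) M &
        countable [set: M] -> countable [set: J] /\ forall j, countable [set: B j]].
Proof.
move=> E.
have tr n (p : formula (withE L) n) : (forall v : n.-tuple (CombE A), sat p v) ->
  forall v : n.-tuple M, sat p v by exact: valid_transfer E.
have Erefl (a : M) : Erel a a.
  by apply/(@sat_fE _ _ ord0 ord0 [tuple a]); apply: tr => v; apply/sat_fE.
have Esym (a b : M) : Erel a b -> Erel b a.
  have H : sat (FImp (@fE 2 ord0 ord_max) (@fE 2 ord_max ord0)) [tuple a; b].
    by apply: tr => v; apply/sat_imp => /sat_fE/Erel_combE H; apply/sat_fE; apply/Erel_combE.
  by move=> /(@sat_fE _ _ ord0 ord_max [tuple a; b])/H/sat_fE.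
have Etrans (a b d : M) : Erel a b -> Erel b d -> Erel a d.
  pose one : 'I_3 := lift ord0 ord0.
  have H : sat (FImp (@fE 3 ord0 one) (FImp (@fE 3 one ord_max) (@fE 3 ord0 ord_max))) [tuple a; b; d].
    apply: tr => v; apply/sat_imp => /sat_fE/Erel_combE H.
    apply/sat_imp => /sat_fE/Erel_combE H'.
    by apply/sat_fE; apply/Erel_combE; rewrite H.
  move=> /(@sat_fE _ _ ord0 one [tuple a; b; d])/H{}H.
  by move=> /(@sat_fE _ _ one ord_max [tuple a; b; d])/H/sat_fE.
have Eloc (r : L) (t : (arity r).-tuple M) i j :
    @interp (withE L) M (Some r) t -> Erel (tnth t i) (tnth t j).
  pose R : formula (withE L) (arity r) :=
    @FRel (withE L) (arity r) (Some r) (ord_tuple (arity r)).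
  have satR (K : structure (withE L)) (v : (arity r).-tuple K) :
      sat R v <-> @interp (withE L) K (Some r) v.
    rewrite /R /= [map_tuple _ _](_ : _ = v) //.
    by apply: eq_from_tnth => k; rewrite tnth_map tnth_ord_tuple.
  have H : sat (FImp R (fE i j)) t.
    apply: tr => v; apply/sat_imp => /satR/=[k [u [-> _]]]; apply/(@sat_fE (CombE A)); apply/Erel_combE.
    by rewrite !tnth_map.
  by move=> /satR/H/sat_fE.
have Eeq (a b : M) : Erel a b <-> [set x | Erel a x] = [set x | Erel b x].
  split=> [ab|e]; last by rewrite -/([set x | Erel a x] b) e; exact: Erefl.
  by apply/seteqP; split=> x /=; apply: Etrans => //; exact: Esym.
pose J := {C : set M | exists a, C = [set x | Erel a x]}.
pose rep (C : J) : M := projT1 (cid (projT2 C)).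
have repE (C : J) : sval C = [set x | Erel (rep C) x] by exact: (projT2 (cid (projT2 C))).
have Jeq (C D : J) a : sval C a -> sval D a -> C = D.
  rewrite !repE /= => Ca Da; apply: sig_inj; rewrite !repE; apply/Eeq.
  by apply: Etrans Ca _; exact: Esym.
pose cls (a : M) : J := exist _ [set x | Erel a x] (ex_intro _ a erefl).
pose B (C : J) := eclass (rep C).
pose f (x : CombE B) : M := sval (projT2 x).
have fC (x : CombE B) : sval (projT1 x) (f x).
  by rewrite repE; exact: (projT2 (projT2 x)).
have finj : injective f.
  move=> [C x] [D y] e; have CD : C = D.
    by apply: (Jeq _ _ (f (existT _ C x))); [exact: (fC (existT _ C x))|rewrite e; exact: (fC (existT _ D y))].
  case: _ / CD y e => y /= e; congr existT; exact: sig_inj.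
exists J, B; split.
- by move=> C; exists; exists (rep C); exact: Erefl.
- exists f; split.
    apply: inj_surj_bij => // a.
    have aC : Erel (rep (cls a)) a by have : sval (cls a) a := Erefl a; rewrite repE.
    by exists (existT (fun C => carrier (B C)) (cls a) (exist _ a aC)).
  move=> [r|] t; last first.
    have -> : @interp (withE L) M None (map_tuple f t) <->
        Erel (f (tnth t ord0)) (f (tnth t ord_max)).
      rewrite /Erel; suff -> : map_tuple f t = [tuple f (tnth t ord0); f (tnth t ord_max)] by [].
      apply: eq_from_tnth => -[[|[|k]] Hk] //; rewrite tnth_map (tnth_nth (f (tnth t ord0))) /=;
        by congr (f (tnth _ _)); exact: val_inj.
    move: (fC (tnth t ord0)) (fC (tnth t ord_max)); rewrite !repE /= => H0 H1.
    split=> [e|E01].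
      by rewrite /= in e; apply: Etrans H1; rewrite -e; exact: Esym.
    apply: (Jeq _ _ (f (tnth t ord0))); rewrite repE //=.
    by apply: Etrans H1 _; exact: Esym.
  split.
  + move=> /= -[C [u [-> iu]]]; rewrite map_tuple_comp; exact: iu.
  + move=> Ht; set C := projT1 (tnth t (Ordinal (arity_gt0 r))).
    have [u e] : exists u, t = map_tuple (existT (fun C => carrier (B C)) C) u.
      apply: (@tuple_existT J (fun C => carrier (B C)) C (arity r) t) => k.
      apply: (Jeq _ _ (f (tnth t k))); first exact: fC.
      have := fC (tnth t (Ordinal (arity_gt0 r))); rewrite -/C repE /= => HC.
      apply: Etrans HC _; have := Eloc _ _ (Ordinal (arity_gt0 r)) k Ht.
      by rewrite !tnth_map.
    exists C, u; split=> //; rewrite /= -(map_tuple_comp (existT (fun C => carrier (B C)) C) f) -e.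
    exact: Ht.
- move=> Mc; split; last first.
    by move=> C; apply: countable_inj Mc; exact: sig_inj.
  apply: (countable_inj (f := rep)) Mc => C D e; apply: sig_inj.
  by rewrite !repE e.
Qed.
End Combinations.

(** * The profile of a combination *)

Section Profiles.
Variable L : language.

(** Comparing all finite numbers of classes identifies the infinite ones, which
    first-order sentences do not distinguish. *)
Definition profile_le I J (A : I -> structure L) (B : J -> structure L) :=
  forall (p : sentence L) n,
    count_ge A (fun X => holds X p) n -> count_ge B (fun X => holds X p) n.

(** Playing the entries of [x] one after the other uses up [k] moves. *)
Lemma types_play (K : language) (M N : structure K) S k q :
  agree (types S (k + q) 0) ([tuple] : 0.-tuple M) ([tuple] : 0.-tuple N) ->
  forall x : k.-tuple M, exists y : k.-tuple N, agree (types S q k) x y.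
Proof.
elim: k q => [|k IH] q; first by move=> H x; exists [tuple]; rewrite tuple0.
rewrite addSn -addnS => /IH{}IH x; case/tupleP: x => a x.
have [y /types_forth-/(_ a)[b H]] := IH x; by exists (cons_tuple b y).
Qed.

Definition extend_index n m (h : 'I_n -> 'I_m) (k : 'I_n.+1) : 'I_m.+1 :=
  if unlift ord0 k is Some k' then lift ord0 (h k') else ord0.

Lemma agree_types_interp (K : language) (M N : structure K) S q n (v : n.-tuple M) (w : n.-tuple N) :
  agree (types S q n) v w ->
  (forall i j, tnth v i = tnth v j <-> tnth w i = tnth w j) /\
  (forall r (t : (arity r).-tuple 'I_n), List.In r S ->
     interp (map_tuple (tnth v) t) <-> interp (map_tuple (tnth w) t)).
Proof. by move=> /types_atoms/agree_atoms. Qed.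

Section ClassGame.
Variables (I J : Type) (A : I -> structure L) (B : J -> structure L).
Local Notation injA := (existT (fun i => carrier (A i))).
Local Notation injB := (existT (fun j => carrier (B j))).
Variables (S : seq L) (i : I) (j : J).

(** The symbols of the combination that matter for a game on classes: E keeps
    the answers inside the right class. *)
Definition symbolsE : seq (withE L) := None :: [seq Some r | r <- S].

(** A position of the game between two classes is part of a position of the
    game between the combinations.  The index [l] points to moves lying in the
    two classes; it is needed as long as [u] and [v] are empty. *)
Definition class_game q n (u : n.-tuple (A i)) (v : n.-tuple (B j)) :=
  exists (m : nat) (a : m.-tuple (CombE A)) (b : m.-tuple (CombE B)),
    agree (types symbolsE q m) a b /\
    exists (h : 'I_n -> 'I_m) (l : 'I_m),
      [/\ forall k, tnth a (h k) = injA i (tnth u k),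
          forall k, tnth b (h k) = injB j (tnth v k),
          projT1 (tnth a l) = i & projT1 (tnth b l) = j].

Lemma class_game_forth q n (u : n.-tuple (A i)) (v : n.-tuple (B j)) x :
  class_game q.+1 u v -> exists y, class_game q (cons_tuple x u) (cons_tuple y v).
Proof.
move=> [m [a [b [H [h [l [ha hb al bl]]]]]]].
have [[j' y] Hy] := types_forth H (injA i x).
have jj' : j = j'.
  have [_ /(_ None [tuple ord0; lift ord0 l])] := agree_types_interp Hy.
  case; first by left.
  rewrite !tuple2_map !Erel_combE !tnthS !tnth0 al bl => /(_ erefl).
  by move=> /= ->.
case: _ / jj' y Hy => y Hy.
exists y, m.+1, (cons_tuple (injA i x) a), (cons_tuple (injB j y) b); split=> //.
exists (extend_index h), ord0; split; rewrite ?tnth0 // => k; rewrite /extend_index;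
  by case: unliftP => [k' ->|->]; rewrite ?tnthS ?tnth0.
Qed.

Lemma class_game_atoms q n (u : n.-tuple (A i)) (v : n.-tuple (B j)) :
  class_game q u v -> agree (atoms S n) u v.
Proof.
move=> [m [a [b [/agree_types_interp[Heq Hrel] [h [l [ha hb al bl]]]]]]].
apply/agree_atoms; split=> [k k'|r t Hr].
  split=> e.
    by apply: (@existT_inj _ (fun j => carrier (B j)) j); rewrite -!hb -Heq !ha e.
  by apply: (@existT_inj _ (fun i => carrier (A i)) i); rewrite -!ha Heq !hb e.
rewrite -!comb_interpE !map_tuple_comp.
rewrite (eq_map_tuple (f := _ \o tnth u) (g := tnth a \o h)); last by move=> k /=; rewrite ha.
rewrite (eq_map_tuple (f := _ \o tnth v) (g := tnth b \o h)); last by move=> k /=; rewrite hb.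
rewrite -(map_tuple_comp h (tnth a)) -(map_tuple_comp h (tnth b)); apply: (Hrel (Some r)); right; apply/In_map; by exists r.
Qed.

End ClassGame.

Lemma class_game_sym I J (A : I -> structure L) (B : J -> structure L) S i j q n
    (u : n.-tuple (A i)) (v : n.-tuple (B j)) :
  class_game S q u v -> class_game S q v u.
Proof.
move=> [m [a [b [H [h [l [ha hb al bl]]]]]]]; exists m, b, a; split; first exact: agree_sym.
by exists h, l.
Qed.

(** Play one element in each of the [n] classes.  The answers lie in different
    classes, since E is preserved, and each of these classes satisfies [p],
    since the game goes on for [rank p] moves inside it. *)
Lemma comb_equiv_profile I J (A : I -> structure L) (B : J -> structure L) :
  (forall i, inhabited (A i)) -> elem_equiv (CombE A) (CombE B) -> profile_le A B.
Proof.
move=> Ane /elem_equivP E p k [f [Pf If]].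
have /dep_choice[a _] : forall i, exists x : A i, True by move=> i; have [x] := Ane i; exists x.
pose S := symbols p; pose x := mktuple (fun l => existT (fun i => carrier (A i)) (f l) (a (f l))) : k.-tuple (CombE A).
have xE l : tnth x l = existT _ (f l) (a (f l)) by rewrite tnth_mktuple.
have [|y Hy] := @types_play _ (CombE A) (CombE B) (symbolsE S) k (rank p) _ x.
  move=> q _; split; first exact: E.
  by move=> Bq; apply: contrapT => nA; exact: (E (fnot q) nA).
exists (fun l => projT1 (tnth y l)); split=> [l|l l' ll'].
  have : class_game S (rank p) ([tuple] : 0.-tuple (A (f l))) ([tuple] : 0.-tuple (B (projT1 (tnth y l)))).
    have h0 m : 'I_0 -> 'I_m by case.
    exists k, x, y; split=> //; exists (h0 k), l; split=> //; [by case|by case|].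
    by rewrite xE.
  move=> z; pose Z := @class_game I J A B S (f l) (projT1 (tnth y l)).
  have Zat q n v w : Z q n v w -> agree (atoms S n) v w by exact: class_game_atoms.
  have Zbf q n v w : Z q.+1 n v w ->
      (forall t, exists t', Z q n.+1 (cons_tuple t v) (cons_tuple t' w)) /\
      (forall t', exists t, Z q n.+1 (cons_tuple t v) (cons_tuple t' w)).
    move=> {}z; split=> t; first exact: class_game_forth.
    have [t' z'] := class_game_forth t (class_game_sym z).
    by exists t'; exact: class_game_sym z'.
  apply/(back_and_forth Zat Zbf (p := p) _ (leqnn _) z); last exact: Pf.
  by [].
have [_ /(_ None [tuple l; l'])] := agree_types_interp Hy.
case; first by left.
rewrite !tuple2_map !Erel_combE !xE /= => _ H /H.
exact: If.
Qed.

Section CombGame.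
Variables (I J : Type) (A : I -> structure L) (B : J -> structure L).
Variables (S : seq L) (Q : nat).
Local Notation injA := (existT (fun i => carrier (A i))).
Local Notation injB := (existT (fun j => carrier (B j))).

Definition partial_bij (s : seq (I * J)) :=
  forall e e', List.In e s -> List.In e' s -> e.1 = e'.1 <-> e.2 = e'.2.

(** The tuples [u] and [v] contain the entries of [a] and [b] that lie in the
    two matched classes.  At the positions of the other entries they contain
    arbitrary moves, so that all tuples have the same length [n]. *)
Definition matched q n (a : n.-tuple (CombE A)) (b : n.-tuple (CombE B)) (e : I * J) :=
  agree (types S Q 0) ([tuple] : 0.-tuple (A e.1)) ([tuple] : 0.-tuple (B e.2)) /\
  exists (u : n.-tuple (A e.1)) (v : n.-tuple (B e.2)),
    [/\ agree (types S q n) u v,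
        forall k x, tnth a k = injA e.1 x -> tnth u k = x &
        forall k y, tnth b k = injB e.2 y -> tnth v k = y].

Definition game_inv q n (a : n.-tuple (CombE A)) (b : n.-tuple (CombE B))
    (s : seq (I * J)) :=
  [/\ partial_bij s,
      forall k, List.In (projT1 (tnth a k), projT1 (tnth b k)) s &
      forall e, List.In e s -> matched q a b e].

(** The total number [Q] of moves is fixed, because classes that are matched in
    the middle of the game have to be equivalent up to [Q]. *)
Definition comb_game q n (a : n.-tuple (CombE A)) (b : n.-tuple (CombE B)) :=
  (n + q)%N = Q /\ exists s, game_inv q a b s.

End CombGame.

Lemma comb_game_sym I J (A : I -> structure L) (B : J -> structure L) S Q q n
    (a : n.-tuple (CombE A)) (b : n.-tuple (CombE B)) :
  comb_game S Q q a b -> comb_game S Q q b a.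
Proof.
move=> [nq [s [s1 s2 s3]]]; split=> //; exists [seq (e.2, e.1) | e <- s]; split.
- by move=> _ _ /In_map[e [<- es]] /In_map[e' [<- es']] /=; rewrite (s1 e e').
- by move=> k; apply/In_map; exists (projT1 (tnth a k), projT1 (tnth b k)).
- move=> _ /In_map[e [<- /s3[H [u [v [uv Hu Hv]]]]]]; split; first exact: agree_sym.
  by exists v, u; split=> //; exact: agree_sym.
Qed.

Section Forth.
Variables (I J : Type) (A : I -> structure L) (B : J -> structure L).
Variables (S : seq L) (Q : nat).
Hypothesis Ane : forall i, inhabited (A i).
Hypothesis AB : profile_le A B.
Local Notation injA := (existT (fun i => carrier (A i))).
Local Notation injB := (existT (fun j => carrier (B j))).

(** A complete description [c] of the class [A i] up to [Q] holds in exactly as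
    many matched classes on either side.  It holds in one more class of [A],
    namely [A i], hence by comparison of profiles in one more class of [B]. *)
Lemma fresh_class (s : seq (I * J)) i :
  partial_bij s ->
  (forall e, List.In e s ->
    agree (types S Q 0) ([tuple] : 0.-tuple (A e.1)) ([tuple] : 0.-tuple (B e.2))) ->
  (forall j, ~ List.In (i, j) s) ->
  exists j, agree (types S Q 0) ([tuple] : 0.-tuple (A i)) ([tuple] : 0.-tuple (B j)) /\
    forall i', ~ List.In (i', j) s.
Proof.
move=> sb sag si; have [c [ctypes ci cN]] := complete_conjs_real (types S Q 0) ([tuple] : 0.-tuple (A i)).
pose P i' := (exists j', List.In (i', j') s) /\ holds (A i') c.
have Pfin : ~ num_ge P eq (size s).+1.
  have cov x : P x -> exists x', List.In x' [seq e.1 | e <- s] /\ x = x'.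
    by move=> [[y xy] _]; exists x; split=> //; apply/In_map; exists (x, y).
  by move=> /(cover_bound (@esym _) (@etrans _) cov); rewrite size_map ltnn.
have [m [/num_ge_eqP[f [finj Pf]] Pm]] := num_ge_max Pfin.
have /AB/num_ge_eqP[g [ginj cg]] : num_ge (fun i => holds (A i) c) eq m.+1.
  apply: (num_ge_extend (f := f) (x := i)) => //.
  - by move=> k; have [] := Pf k.
  - by move=> k l kl /finj kl'; rewrite kl' eqxx in kl.
  - by move=> k ik; have [[j ij] _] := Pf k; apply: (si j); rewrite ik.
have [[l Hl]|H] := pselect (exists l, forall i', ~ List.In (i', g l) s).
  by exists (g l); split=> //; exact: cN (cg l).
exfalso; apply: Pm; have /choice[h Hh] : forall l, exists i', List.In (i', g l) s.
  by move=> l; apply: contrapT => nl; apply: H; exists l => i' il; apply: nl; exists i'.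
apply/num_ge_eqP; exists h; split=> [l l' ll'|l].
  by apply: ginj; apply/(sb _ _ (Hh l) (Hh l')).
split; first by exists (g l).
apply/(complete_conjs_agree ctypes (sag _ (Hh l))); exact: cg.
Qed.

Lemma game_inv_extend q n (a : n.-tuple (CombE A)) (b : n.-tuple (CombE B)) s i :
  (n + q)%N = Q -> game_inv S Q q a b s ->
  exists s' j, List.In (i, j) s' /\ game_inv S Q q a b s'.
Proof.
move=> nq [s1 s2 s3].
have [[j ij]|nij] := pselect (exists j, List.In (i, j) s); first by exists s, j.
have si j : ~ List.In (i, j) s by move=> ij; apply: nij; exists j.
have [|j [ij sj]] := @fresh_class s i s1 _ si; first by move=> e es; have [] := s3 e es.
exists ((i, j) :: s), j; split; first by left.
split.
- move=> e e' [<-|es] [<-|e's] //=; last exact: s1.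
    case: e' e's => i' j' e's /=; split=> [ie|je]; exfalso.
      by apply: (si j'); rewrite ie.
    by apply: (sj i'); rewrite je.
  case: e es => i' j' es /=; split=> [ie|je]; exfalso.
    by apply: (si j'); rewrite -ie.
  by apply: (sj i'); rewrite -je.
- by move=> k; right.
- move=> e [<-|/s3//]; split=> //=; have [x] := Ane i.
  (* The [n] earlier moves were made in other classes: fill them with [x]. *)
  have ijn : agree (types S (n + q) 0) ([tuple] : 0.-tuple (A i)) ([tuple] : 0.-tuple (B j)).
    by rewrite nq.
  have [v uv] := types_play ijn (nseq_tuple n x).
  exists (nseq_tuple n x), v; split=> // k t e'; exfalso.
    by apply: (si (projT1 (tnth b k))); have := s2 k; rewrite e'.
  by apply: (sj (projT1 (tnth a k))); have := s2 k; rewrite e'.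
Qed.

Lemma comb_game_forth q n (a : n.-tuple (CombE A)) (b : n.-tuple (CombE B)) x :
  comb_game S Q q.+1 a b -> exists y, comb_game S Q q (cons_tuple x a) (cons_tuple y b).
Proof.
move=> [nq [s0 /(game_inv_extend (projT1 x) nq)[s [j [xj [s1 s2 s3]]]]]].
case: x xj => i x0 /= ij.
have [ag [u [v [uv Hu Hv]]]] := s3 _ ij.
have [/= y0 uv0] := types_forth uv x0.
exists (injB j y0); split; first by rewrite addSnnS.
exists s; split=> //.
  by move=> k; case: (unliftP ord0 k) => [k' ->|->]; rewrite ?tnthS ?tnth0.
move=> e es; have [[ie je]|ne] := pselect (i = e.1 /\ j = e.2).
  case: e es ie je => i' j' es /= ii' jj'; case: _ / ii' es; case: _ / jj' => es.
  split=> //; exists (cons_tuple x0 u), (cons_tuple y0 v); split=> // k t;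
    case: (unliftP ord0 k) => [k' ->|->]; rewrite ?tnthS ?tnth0.
  - exact: Hu.
  - exact: existT_inj.
  - exact: Hv.
  - exact: existT_inj.
have [ag' [u' [v' [uv' Hu' Hv']]]] := s3 _ es.
have [z] := Ane e.1; have [z' zz'] := types_forth uv' z.
split=> //; exists (cons_tuple z u'), (cons_tuple z' v'); split=> // k t;
  case: (unliftP ord0 k) => [k' ->|->]; rewrite ?tnthS ?tnth0.
- exact: Hu'.
- move=> /(congr1 (@projT1 _ _))/= ie; case: ne; split=> //.
  exact/(s1 _ _ ij es).
- exact: Hv'.
- move=> /(congr1 (@projT1 _ _))/= je; case: ne; split=> //.
  exact/(s1 _ _ ij es).
Qed.

End Forth.

Lemma In_pmap_id T (x : T) (s : seq (option T)) :
  List.In (Some x) s -> List.In x (pmap id s).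
Proof.
elim: s => //= -[y|] s IH [] //= => [[->]|/IH]; [by left|by right].
Qed.

Lemma comb_game_interp I J (A : I -> structure L) (B : J -> structure L)
    (S : seq (withE L)) Q q n
    (a : n.-tuple (CombE A)) (b : n.-tuple (CombE B)) :
  comb_game (pmap id S) Q q a b ->
  (forall i j, tnth a i = tnth a j -> tnth b i = tnth b j) /\
  (forall r (t : (arity r).-tuple 'I_n), List.In r S ->
     interp (map_tuple (tnth a) t) -> interp (map_tuple (tnth b) t)).
Proof.
move=> [_ [s [s1 s2 s3]]]; split=> [k l|].
  have [ag [u [v [/agree_types_interp[Heq _] Hu Hv]]]] := s3 _ (s2 k).
  have tkl : projT1 (tnth a k) = projT1 (tnth a l) ->
      projT1 (tnth b k) = projT1 (tnth b l) by apply: (s1 _ _ (s2 k) (s2 l)).1.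
  move=> e; have {}tkl := tkl (congr1 (@projT1 _ _) e).
  have bk : tnth b k = existT (fun j => carrier (B j)) (projT1 (tnth b k)) (projT2 (tnth b k)).
    by case: (tnth b k).
  have [bl bkl] : exists y, tnth b l = existT (fun j => carrier (B j)) (projT1 (tnth b k)) y.
    by rewrite tkl; case: (tnth b l) => j y; exists y.
  have ak : tnth a k = existT (fun j => carrier (A j)) (projT1 (tnth a k)) (projT2 (tnth a k)).
    by case: (tnth a k).
  rewrite bk bkl -(Hv _ _ bk) -(Hv _ _ bkl).
  congr existT; apply/Heq; rewrite (Hu _ _ ak) (Hu l (projT2 (tnth a k))) //.
  by rewrite -e.
move=> [r|] t rS; last first.
  have -> : t = [tuple tnth t ord0; tnth t ord_max].
    apply: eq_from_tnth => -[[|[|k]] Hk] //; rewrite [RHS](tnth_nth (tnth t ord0)) /=;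
      by congr tnth; exact: val_inj.
  by rewrite !tuple2_map !Erel_combE; apply: (s1 _ _ (s2 _) (s2 _)).1.
move=> [i [u0 [e iu0]]].
pose l0 := tnth t (Ordinal (arity_gt0 r)).
have al l : tnth a (tnth t l) = existT (fun i => carrier (A i)) i (tnth u0 l).
  by have := congr1 (fun t => tnth t l) e; rewrite !tnth_map.
have ai : projT1 (tnth a l0) = i by rewrite al.
have := s2 l0; rewrite ai; set j := projT1 (tnth b l0) => ij.
have [_ [u [v [/agree_types_interp[_ Hrel] /= Hu Hv]]]] := s3 _ ij.
have [v0 v0E] : exists v0, map_tuple (tnth b) t = map_tuple (existT (fun j => carrier (B j)) j) v0.
  apply: (@tuple_existT J (fun j => carrier (B j)) j (arity r)) => l.
  rewrite tnth_map; apply/esym/(s1 _ _ ij (s2 _)) => /=; by rewrite al.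
exists j, v0; split=> //.
have -> : v0 = map_tuple (tnth v) t.
  apply: eq_from_tnth => l; rewrite tnth_map; apply/esym/Hv.
  by have := congr1 (fun t => tnth t l) v0E; rewrite !tnth_map.
apply/Hrel.
  exact: In_pmap_id.
rewrite [map_tuple _ _](_ : _ = u0) //.
by apply: eq_from_tnth => l; rewrite tnth_map; exact: Hu.
Qed.

(** The Feferman-Vaught theorem for disjoint unions.  The second player keeps
    matched classes equivalent; when a new class is entered, the profiles
    provide a fresh class that is equivalent to it. *)
Lemma profile_comb_equiv I J (A : I -> structure L) (B : J -> structure L) :
  (forall i, inhabited (A i)) -> (forall j, inhabited (B j)) ->
  profile_le A B -> profile_le B A -> elem_equiv (CombE A) (CombE B).
Proof.
move=> Ane Bne AB BA; apply/elem_equivP => p.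
pose S := symbols p; pose Q := rank p.
have z : comb_game (pmap id S) Q Q ([tuple] : 0.-tuple (CombE A)) ([tuple] : 0.-tuple (CombE B)).
  by split=> //; exists [::]; split=> // -[].
apply: (back_and_forth (S := S) (Z := comb_game (pmap id S) Q) _ _ _ _ z).1 => //.
  move=> q n v w {}z; apply/agree_atoms.
  have [H1 H2] := comb_game_interp z; have [H1' H2'] := comb_game_interp (comb_game_sym z).
  by split=> [i j|r t Hr]; split; auto.
move=> q n v w {}z; split=> t; first exact: comb_game_forth.
have [t' z'] := comb_game_forth Bne BA t (comb_game_sym z).
by exists t'; exact: comb_game_sym z'.
Qed.

End Profiles.

(** * Ultraproducts *)

Section Ultraproduct.
Variables (L : language) (I : Type) (A : I -> structure L) (U : set_system I).
Hypothesis Ane : forall i, inhabited (A i).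
Context {UU : UltraFilter U}.
Local Notation P := (forall i, A i).

(** The quotient of the product by equality almost everywhere, as a set of
    classes, so that equality of the ultraproduct is genuine equality. *)
Definition ultra_carrier := {C : set P | exists f, C = [set g | U [set i | f i = g i]]}.

Definition ultra_class (f : P) : ultra_carrier :=
  exist _ [set g | U [set i | f i = g i]] (ex_intro _ f erefl).

Definition ultra_rep (C : ultra_carrier) : P := projT1 (cid (projT2 C)).

Definition ultraproduct : structure L :=
  @Structure L ultra_carrier
    (fun r t => U [set i | interp (map_tuple (fun C => ultra_rep C i) t)]).

Lemma ultra_repE C : sval C = [set g | U [set i | ultra_rep C i = g i]].
Proof. exact: (projT2 (cid (projT2 C))). Qed.

Lemma ultra_eqP (C D : ultra_carrier) :
  C = D <-> U [set i | ultra_rep C i = ultra_rep D i].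
Proof.
split=> [->|H]; first exact: filterS filterT.
apply: sig_inj; rewrite !ultra_repE; apply/seteqP; split=> g /= Hg.
  by apply: filterS2 H Hg => i /= <-.
by apply: filterS2 H Hg => i /= ->.
Qed.

Lemma ultra_rep_class f : U [set i | ultra_rep (ultra_class f) i = f i].
Proof.
have : sval (ultra_class f) f by apply: filterS filterT.
by rewrite ultra_repE.
Qed.

Theorem Los n (p : formula L n) (v : n.-tuple ultraproduct) :
  sat p v <-> U [set i | sat p (map_tuple (fun C => ultra_rep C i) v)].
Proof.
elim: p v => {n} [n k l|n r t|n|n p IHp q IHq|n p IHp] v.
- rewrite /= ultra_eqP; split; apply: filterS => i /=; by rewrite !tnth_map.
- by split; apply: filterS => i /=; rewrite map_tnth_map.
- by split=> // U0; apply: (filter_not_empty U); apply: filterS U0.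
- rewrite sat_imp IHp IHq; split=> [H|Hpq Hp].
    have [/H|] := in_ultra_setVsetC [set i | sat p (map_tuple (fun C => ultra_rep C i) v)] UU.
      by apply: filterS => i /= Hq _.
    by apply: filterS => i /= np pi; case: np.
  by apply: filterS2 Hpq Hp => i /= Hpq Hp; exact: Hpq.
- split=> [H|H x]; last first.
    by apply/IHp; apply: filterS H => i /= H; rewrite map_cons_tuple; exact: H.
  have [//|nH] := in_ultra_setVsetC [set i | sat (FAll p) (map_tuple (fun C => ultra_rep C i) v)] UU.
  have /dep_choice[f Hf] : forall i, exists x : A i,
      ~ sat (FAll p) (map_tuple (fun C => ultra_rep C i) v) ->
      ~ sat p (cons_tuple x (map_tuple (fun C => ultra_rep C i) v)).
    move=> i; have [x0] := Ane i.
    have [[x Hx]|nx] := pselect (exists x, ~ sat p (cons_tuple x (map_tuple (fun C => ultra_rep C i) v))).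
      by exists x.
    by exists x0; case=> x; apply: contrapT => nx'; apply: nx; exists x.
  have /IHp Hc := H (ultra_class f).
  exfalso; apply: (filter_not_empty U); apply: filterS (filterI (filterI Hc nH) (ultra_rep_class f)).
  by move=> i /= [[]]; rewrite map_cons_tuple => H1 H2 H3; apply: Hf H2 _; rewrite -H3.
Qed.

Corollary Los_holds (p : sentence L) :
  holds ultraproduct p <-> U [set i | holds (A i) p].
Proof. by rewrite /holds Los; split; apply: filterS => i /=; rewrite [map_tuple _ _]tuple0. Qed.

Lemma ultraproduct_inhabited : inhabited ultraproduct.
Proof.
have /dep_choice[f _] : forall i, exists x : A i, True by move=> i; have [x] := Ane i; exists x.
by exists; exact: ultra_class f.
Qed.

End Ultraproduct.

(** * Countable elementary substructures *)

Section LowenheimSkolem.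
Variables (L : language).
Hypothesis Lc : countable [set: L].

Local Notation code := (GenTree.tree (nat * nat + nat * seq nat)%type).

Section Coding.
Variables (f : L -> nat) (g : nat -> option L).
Hypothesis fK : pcancel f g.

Fixpoint encode n (p : formula L n) : code :=
  match p with
  | FEq _ i j => GenTree.Leaf (inl (val i, val j))
  | FRel _ r t => GenTree.Leaf (inr (f r, map val t))
  | FBot _ => GenTree.Node 0 [::]
  | FImp _ p q => GenTree.Node 0 [:: encode p; encode q]
  | FAll _ p => GenTree.Node 0 [:: encode p]
  end.

(** Decoding into an option for every [n] avoids inverting the indexed type of
    formulas when [encode] is shown to be injective. *)
Fixpoint decode (c : code) n : option (formula L n) :=
  match c with
  | GenTree.Leaf (inl (i, j)) =>
      if (insub i : option 'I_n, insub j : option 'I_n) is (Some i', Some j')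
      then Some (FEq L i' j') else None
  | GenTree.Leaf (inr (k, s)) =>
      if g k is Some r then
        if insub (pmap (insub : nat -> option 'I_n) s) is Some t
        then Some (@FRel L n r t) else None
      else None
  | GenTree.Node _ [:: c1; c2] =>
      if (decode c1 n, decode c2 n) is (Some p, Some q) then Some (FImp p q) else None
  | GenTree.Node _ [:: c1] =>
      if decode c1 n.+1 is Some p then Some (FAll p) else None
  | _ => Some (FBot L n)
  end.

Lemma encodeK n (p : formula L n) : decode (encode p) n = Some p.
Proof.
elim: p => {n} [n i j|n r t|n|n p IHp q IHq|n p IHp] //=.
- by rewrite !valK.
- by rewrite fK (map_pK valK) valK.
- by rewrite IHp IHq.
- by rewrite IHp.
Qed.

End Coding.

Lemma countable_formula n : countable [set: formula L n].
Proof.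
have /countable_injP[f finj] := Lc.
pose g k := if pselect (exists r, f r = k) is left h then Some (projT1 (cid h)) else None.
have fK : pcancel f g.
  move=> r; rewrite /g; case: pselect => [h|[]]; last by exists r.
  by congr Some; apply: finj; rewrite ?inE //; exact: projT2 (cid h).
apply: (countable_inj (f := @encode f n)); last exact: countableP.
by apply: (pcan_inj (g := fun c => decode g c n)) => p; exact: encodeK.
Qed.

Section SkolemHull.
Variables (M : structure L) (x0 : M) (num : forall n, formula L n -> nat).
Hypothesis num_inj : forall n, injective (@num n).

(** The list [s] is untyped with respect to its length, because the arguments of
    a Skolem term form a list; the length is recovered from the tuple [v]. *)
Definition is_witness k (s : seq M) (x : M) := exists n (p : formula L n.+1) (v : n.-tuple M),
  [/\ num p = k, tval v = s & sat p (cons_tuple x v)].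

Definition witness k (s : seq M) : M :=
  if pselect (exists x, is_witness k s x) is left h then projT1 (cid h) else x0.

(** The trees are Skolem terms: a node carries the number of a formula, and its
    children are the parameters of that formula.  There are countably many of
    them, and their values are closed under witnesses by construction. *)
Fixpoint skolem_eval (t : GenTree.tree nat) : M :=
  match t with
  | GenTree.Leaf _ => x0
  | GenTree.Node k l => witness k (map skolem_eval l)
  end.

Lemma witnessP n (p : formula L n.+1) (v : n.-tuple M) x :
  sat p (cons_tuple x v) -> sat p (cons_tuple (witness (num p) v) v).
Proof.
move=> px; rewrite /witness; case: pselect => [h|[]]; last by exists x, n, p, v.
case: (cid h) => y /= [m [q [w [qp wv qy]]]].
have mn : m = n by rewrite -(size_tuple v) -wv size_tuple.
case: _ / (esym mn) q w qp wv qy => q w /num_inj -> /val_inj ->.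
by [].
Qed.

Definition skolem_hull : structure L :=
  @Structure L {x : M | exists t, skolem_eval t = x}
    (fun r t => interp (map_tuple (@sval M _) t)).

Lemma skolem_hull_sat n (p : formula L n) (v : n.-tuple skolem_hull) :
  sat p v <-> sat p (map_tuple (@sval M _) v).
Proof.
elim: p v => {n} [n i j|n r t|n|n p IHp q IHq|n p IHp] v //=.
- by rewrite !tnth_map; split=> [->|/sig_inj].
- by rewrite map_tnth_map.
- by rewrite IHp IHq.
split=> H x; last by rewrite IHp map_cons_tuple.
apply: contrapT => /(@witnessP _ (fnot p)) Hw.
have [t Ht] : exists t, skolem_eval t = witness (num (fnot p)) (map_tuple (@sval M _) v).
  have /choice[u Hu] : forall k, exists t, skolem_eval t = sval (tnth v k).
    by move=> k; exact: (projT2 (tnth v k)).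
  exists (GenTree.Node (num (fnot p)) (mktuple u)) => /=; congr witness.
  rewrite -[LHS]/(tval (map_tuple skolem_eval (mktuple u))); congr tval.
  by apply: eq_from_tnth => k; rewrite !tnth_map Hu tnth_ord_tuple.
apply: Hw; rewrite -Ht; move: (H (exist _ (skolem_eval t) (ex_intro _ t erefl))).
by rewrite IHp map_cons_tuple.
Qed.

End SkolemHull.

Theorem Lowenheim_Skolem (M : structure L) : inhabited M ->
  exists N : structure L, [/\ inhabited N, countable [set: N] & elem_equiv N M].
Proof.
move=> [x0].
have /dep_choice[num num_inj] : forall n, exists num : formula L n -> nat, injective num.
  by move=> n; have /countable_injP[f finj] := countable_formula n; exists f => p q; apply: finj; rewrite inE.
exists (skolem_hull x0 num); split.
- by exists; exists x0; exists (GenTree.Leaf 0).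
- pose h t : skolem_hull x0 num := exist _ (skolem_eval x0 num t) (ex_intro _ t erefl).
  apply: (countable_surj (f := h)); last exact: countableP.
  by move=> [x [t e]]; exists t; exact: eq_exist.
- apply/elem_equivP => p; rewrite /holds skolem_hull_sat //.
  by rewrite [map_tuple _ _]tuple0.
Qed.

End LowenheimSkolem.

(** * Finite models *)

Section FiniteModels.
Variable L : language.

Definition covers n : formula L n :=
  FAll (fnot (fconj [seq fnot (FEq L ord0 (lift ord0 k)) | k <- enum 'I_n])).

Lemma sat_covers (M : structure L) n (v : n.-tuple M) :
  sat (covers n) v <-> forall x, exists k, tnth v k = x.
Proof.
split=> H x.
  apply: contrapT => nk; have := H x; apply; apply/sat_conj => _ /In_map[k [<- _]].
  by rewrite sat_not /= tnth0 tnthS => e; apply: nk; exists k.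
move=> /sat_conj Hx; have [k e] := H x.
have : List.In (fnot (FEq L ord0 (lift ord0 k))) [seq fnot (FEq L ord0 (lift ord0 k)) | k <- enum 'I_n].
  by apply/In_map; exists k; split=> //; apply/In_mem; rewrite mem_enum.
by move=> /Hx; rewrite sat_not; apply; rewrite /= tnth0 tnthS.
Qed.

(** Let [a] enumerate [M].  If no tuple [b] of [N] satisfied all formulas
    satisfied by [a], choosing for each of the finitely many tuples of [N] a
    formula that it violates would give a conjunction which is satisfiable in
    [M] and not in [N], even when the language is infinite. *)
Lemma finite_elem_equiv_iso (M N : structure L) :
  finite_set [set: M] -> elem_equiv M N -> iso M N.
Proof.
move=> /(@finite_seqP {classic M})[s sM] /elem_equivP MN.
have [n [a acov]] : exists n (a : n.-tuple M), forall x, exists k, tnth a k = x.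
  exists (size s), (in_tuple s) => x.
  have xs : x \in (s : seq {classic M}) by have : [set` s] x by rewrite -sM.
  have xs' : (@index {classic M} x s < size s)%N by rewrite index_mem.
  exists (Ordinal xs'); rewrite (tnth_nth x) /=.
  exact: (@nth_index {classic M}).
have [b Hb] : exists b : n.-tuple N, forall p : formula L n, sat p a -> sat p b.
  have /MN/holds_exs[b0 /sat_covers b0cov] : holds M (fexs (covers n)).
    by apply/holds_exs; exists a; apply/sat_covers.
  apply: contrapT => nb.
  have /choice[q Hq] : forall h : n.-tuple 'I_n, exists p : formula L n,
      sat p a /\ ~ sat p (map_tuple (tnth b0) h).
    move=> h; apply: contrapT => nq; apply: nb; exists (map_tuple (tnth b0) h) => p pa.
    by apply: contrapT => npb; apply: nq; exists p.
  have /MN/holds_exs[b /sat_conj Hb] :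
      holds M (fexs (fconj [seq q h | h <- enum {: n.-tuple 'I_n}])).
    apply/holds_exs; exists a; apply/sat_conj => _ /In_map[h [<- _]].
    exact: (Hq h).1.
  have /choice[h Hh] : forall k, exists l, tnth b0 l = tnth b k by move=> k; exact: b0cov.
  apply: (Hq (mktuple h)).2; rewrite [map_tuple _ _](_ : _ = b).
    apply: Hb; apply/In_map; exists (mktuple h); split=> //; apply/In_mem.
    by rewrite mem_enum.
  by apply: eq_from_tnth => k; rewrite !tnth_map tnth_ord_tuple.
have ab (p : formula L n) : sat p a <-> sat p b.
  split; first exact: Hb.
  by move=> pb; apply: contrapT => npa; exact: (Hb (fnot p) npa).
have [k kE] := choice acov.
have ab_eq i j : tnth a i = tnth a j <-> tnth b i = tnth b j by exact: (ab (FEq L i j)).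
exists (fun x => tnth b (k x)); split.
  apply: inj_surj_bij => [x y /ab_eq|y]; first by rewrite !kE.
  have /ab/sat_covers/(_ y)[l <-] : sat (covers n) a by apply/sat_covers.
  by exists (tnth a l); apply/ab_eq; rewrite kE.
move=> r t; have := ab (FRel (map_tuple k t)); rewrite /= !map_tuple_comp.
rewrite [X in interp X](_ : _ = t); last by apply: eq_from_tnth => l; rewrite tnth_map /= kE.
by [].
Qed.

End FiniteModels.

(** * Limits and class theories *)

Section Families.
Variable L : language.
Implicit Types (I J K : Type) (X Y : structure L).

(** [X] is an accumulation point of the theories of the [A i], counted with
    multiplicity. *)
Definition limit_of I (A : I -> structure L) X :=
  forall p : sentence L, holds X p -> forall n, count_ge A (fun Y => holds Y p) n.

Definition family_sum I K (A : I -> structure L) (D : K -> structure L) (x : I + K) :=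
  match x with inl i => A i | inr k => D k end.

Definition subfamily I (A : I -> structure L) (P : I -> Prop) (i : {i | P i}) := A (sval i).
Arguments subfamily {I} A P i.

Lemma elem_equiv_refl X : elem_equiv X X. Proof. by []. Qed.

Lemma elem_equiv_holds X Y (p : sentence L) : elem_equiv X Y -> holds X p <-> holds Y p.
Proof. by move=> E; rewrite -[holds X p]/(Th X p) E. Qed.

Lemma count_ge_sub I (A : I -> structure L) (P Q : structure L -> Prop) n :
  (forall i, P (A i) -> Q (A i)) -> count_ge A P n -> count_ge A Q n.
Proof. by move=> PQ; apply: (num_ge_map (h := id)). Qed.

Lemma count_ge1 I (A : I -> structure L) (Q : structure L -> Prop) :
  count_ge A Q 1 <-> exists i, Q (A i).
Proof.
split=> [[f [Qf _]]|[i Qi]]; first by exists (f ord0).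
by exists (fun=> i); split=> // k l; rewrite !ord1 eqxx.
Qed.

Lemma family_sum_inhabited I K (A : I -> structure L) (D : K -> structure L) :
  (forall i, inhabited (A i)) -> (forall k, inhabited (D k)) ->
  forall x, inhabited (family_sum A D x).
Proof. by move=> Ane Dne []. Qed.

(** A sentence true in an added class already holds in infinitely many classes,
    so the profile does not change. *)
Lemma comb_add_limits I K (A : I -> structure L) (D : K -> structure L) :
  (forall i, inhabited (A i)) -> (forall k, inhabited (D k)) ->
  (forall k, limit_of A (D k)) -> elem_equiv (CombE A) (CombE (family_sum A D)).
Proof.
move=> Ane Dne lim; apply: profile_comb_equiv => //; first exact: family_sum_inhabited.
  by move=> p n; apply: (num_ge_map (h := inl)) => // i i' _ _ [].
move=> p n [f [Pf If]]; have [[k Dk]|nD] := pselect (exists k, holds (D k) p).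
  exact: lim Dk n.
have /choice[g Hg] : forall l, exists i, f l = inl i.
  move=> l; case e: (f l) => [i|k]; first by exists i.
  by case: nD; exists k; have := Pf l; rewrite e.
exists g; split=> [l|l l' ll' gg]; first by have := Pf l; rewrite Hg.
by apply: If ll' _; rewrite !Hg gg.
Qed.

Lemma comb_remove_limit I (A : I -> structure L) X :
  (forall i, inhabited (A i)) ->
  limit_of (subfamily A (fun i => ~ elem_equiv (A i) X)) X ->
  elem_equiv (CombE A) (CombE (subfamily A (fun i => ~ elem_equiv (A i) X))).
Proof.
move=> Ane lim; apply: profile_comb_equiv => //; last first.
- by move=> p n; apply: (num_ge_map (h := sval)) => // x y _ _; exact: sig_inj.
- move=> p n [f [Pf If]]; have [Xp|nX] := pselect (holds X p); first exact: lim.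
  have Hf l : ~ elem_equiv (A (f l)) X by move=> /(elem_equiv_holds p)[/(_ (Pf l))].
  exists (fun l => exist (fun i => ~ elem_equiv (A i) X) (f l) (Hf l)); split=> // l l' ll' [].
  exact: If.
- by move=> [i Hi]; exact: Ane.
Qed.

(** If a sentence true in [B j] held in finitely many [A i] only, its conjunction
    with sentences separating [B j] from each of these would hold in a class of
    [B] and in no class of [A]. *)
Lemma missing_class_limit I J (A : I -> structure L) (B : J -> structure L) j :
  (forall j, inhabited (B j)) ->
  elem_equiv (CombE A) (CombE B) -> (forall i, ~ elem_equiv (A i) (B j)) ->
  limit_of A (B j).
Proof.
move=> Bne E miss p Bp n; apply: contrapT => nA.
have [s Hs] := bounded_cover (@esym _) (@erefl _) nA.
have /choice[q Hq] : forall i, exists q, holds (B j) q /\ ~ holds (A i) q.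
  by move=> i; apply: not_elem_equiv => /elem_equiv_sym; exact: miss.
have : count_ge B (fun Y => holds Y (fand p (fconj (map q s)))) 1.
  apply/count_ge1; exists j; apply/holds_and; split=> //; apply/holds_conj.
  by move=> _ /In_map[i [<- _]]; exact: (Hq i).1.
move=> /(comb_equiv_profile Bne (elem_equiv_sym E))/count_ge1[i /holds_and[Ap /holds_conj H]].
have [i' [i's ii']] := Hs _ Ap; case: (Hq i) => _; apply; apply: H.
by apply/In_map; exists i; rewrite ii'.
Qed.

Definition finitely_many_theories I (A : I -> structure L) :=
  num_lt_omega (fun _ : I => True) (fun i i' => elem_equiv (A i) (A i')).

Lemma finitely_many_theories_cover I (A : I -> structure L) :
  finitely_many_theories A ->
  exists s : seq I, forall i, exists i', List.In i' s /\ elem_equiv (A i) (A i').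
Proof.
move=> [n nA].
have [s Hs] := bounded_cover (fun i i' => @elem_equiv_sym _ (A i) (A i'))
  (fun i => elem_equiv_refl (A i)) nA.
by exists s => i; exact: Hs.
Qed.

(** Finitely many sentences separate [X] from the theories that are different
    from its own. *)
Lemma isolating_sentence I (A : I -> structure L) X :
  finitely_many_theories A ->
  exists p, holds X p /\ forall i, holds (A i) p -> elem_equiv (A i) X.
Proof.
move=> /finitely_many_theories_cover[s Hs].
have /choice[q Hq] : forall i, exists q, holds X q /\ (holds (A i) q -> elem_equiv (A i) X).
  move=> i; have [E|/not_elem_equiv[q [Xq Aq]]] := pselect (elem_equiv X (A i)).
    by exists (fnot (FBot L 0)); split=> // _; exact: elem_equiv_sym.
  by exists q.
exists (fconj (map q s)); split.
  by apply/holds_conj => _ /In_map[i [<- _]]; exact: (Hq i).1.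
move=> i /holds_conj H; have [i' [i's E]] := Hs i; apply: (elem_equiv_trans E).
apply: (Hq i').2; apply/(elem_equiv_holds _ E); apply: H.
by apply/In_map; exists i'.
Qed.

(** The sentence isolating Th(X) among the [A i] also isolates it among the
    [B j], because no class of either combination satisfies it together with a
    sentence false in [X]. *)
Lemma theory_counts I J (A : I -> structure L) (B : J -> structure L) X n :
  (forall i, inhabited (A i)) -> (forall j, inhabited (B j)) ->
  finitely_many_theories A -> elem_equiv (CombE A) (CombE B) ->
  count_ge A (fun Y => elem_equiv Y X) n <-> count_ge B (fun Y => elem_equiv Y X) n.
Proof.
move=> Ane Bne Afin E; have [p [Xp Ap]] := isolating_sentence X Afin.
have AB := comb_equiv_profile Ane E; have BA := comb_equiv_profile Bne (elem_equiv_sym E).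
have Bp j : holds (B j) p -> elem_equiv (B j) X.
  move=> Bjp; apply: contrapT => nE.
  have [q [Xq Bq]] : exists q, holds X q /\ ~ holds (B j) q.
    by apply: not_elem_equiv => /elem_equiv_sym.
  have /BA/count_ge1[i /holds_and[/Ap Ei Aq]] :
      count_ge B (fun Y => holds Y (fand p (fnot q))) 1.
    by apply/count_ge1; exists j; apply/holds_and.
  by apply: Aq; apply/(elem_equiv_holds _ Ei).
have Xsub Y : elem_equiv Y X -> holds Y p by move=> /(elem_equiv_holds p)->.
split=> H.
  apply: count_ge_sub (AB p n _) => [j|]; first exact: Bp.
  by apply: count_ge_sub H => i; exact: Xsub.
apply: count_ge_sub (BA p n _) => [j|]; first exact: Ap.
by apply: count_ge_sub H => i; exact: Xsub.
Qed.

(** The ultrafilter contains the complement of each elementary equivalence class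
    of indices.  Its sets are therefore infinite even after deletion of the
    classes equivalent to the ultraproduct [X], so [X] is a limit of the
    remaining ones. *)
Lemma infinitely_many_theories_limit I (A : I -> structure L) :
  (forall i, inhabited (A i)) -> ~ finitely_many_theories A ->
  exists (J : Type) (B : J -> structure L) (X : structure L),
    [/\ forall j, inhabited (B j), inhabited X, elem_equiv (CombE A) (CombE B),
        limit_of B X & forall j, ~ elem_equiv (B j) X].
Proof.
move=> Ane Ainf.
(* Sets containing all indices outside finitely many elementary equivalence
   classes; they form a proper filter as there are infinitely many such classes. *)
pose F : set_system I := [set S | exists s : seq I,
  forall i, (forall i', List.In i' s -> ~ elem_equiv (A i) (A i')) -> S i].
have Fcover (s : seq I) : exists i, forall i', List.In i' s -> ~ elem_equiv (A i) (A i').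
  apply: contrapT => ns.
  have cov i : True -> exists i', List.In i' s /\ elem_equiv (A i) (A i').
    move=> _; apply: contrapT => ni; apply: ns; exists i => i' i's E.
    by apply: ni; exists i'.
  have := cover_bound (fun i i' => @elem_equiv_sym _ (A i) (A i'))
    (fun i i' i'' => @elem_equiv_trans _ (A i) (A i') (A i''))
    cov (not_num_lt_omega (size s).+1 Ainf).
  by rewrite ltnn.
have Ffilter : Filter F.
  split.
  - by exists [::].
  - move=> S T [s Hs] [t Ht]; exists (s ++ t) => i Hi.
    by split; [apply: Hs|apply: Ht] => i' Hi'; apply: Hi; apply/In_cat; [left|right].
  - by move=> S T ST [s Hs]; exists s => i /Hs; exact: ST.
have Fproper : ProperFilter F.
  by apply: Build_ProperFilter => -[s Hs]; have [i /Hs] := Fcover s.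
have [U [UU FU]] := ultraFilterLemma Fproper.
pose X := ultraproduct A U.
have Xne : inhabited X by exact: ultraproduct_inhabited.
pose P i := ~ elem_equiv (A i) X.
have UP : U P.
  have [H|H] := pselect (exists i, elem_equiv (A i) X); last first.
    by apply: filterS filterT => i _ Ei; apply: H; exists i.
  have [i Ei] := H; apply: FU; exists [:: i] => i' Hi' Ei'; apply: (Hi' i); first by left.
  by apply: elem_equiv_trans Ei' _; exact: elem_equiv_sym.
have lim : limit_of (subfamily A P) X.
  move=> p /(Los_holds Ane) Up n; apply: contrapT => nA.
  have [s Hs] := bounded_cover (@esym _) (@erefl _) nA.
  have Us : U [set i | forall i', List.In i' (map sval s) -> ~ elem_equiv (A i) (A i')].
    by apply: FU; exists (map sval s).
  have [i [[Pi Ai] Hi]] := filter_ex (filterI (filterI UP Up) Us).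
  have [[i' Pi'] [i's /(congr1 sval)/= e]] := Hs (exist _ i Pi) Ai.
  apply: (Hi i); last exact: elem_equiv_refl.
  by apply/In_map; exists (exist _ i' Pi').
exists {i | P i}, (subfamily A P), X; split=> //.
- by move=> [i Pi]; exact: Ane.
- exact: comb_remove_limit.
- by move=> [i Pi].
Qed.

(** For each sentence and each [n], keep [n] classes satisfying the sentence if
    there are as many; then shrink each class by the Lowenheim-Skolem theorem.
    The resulting profile is the original one, and no new class theory appears,
    which an application of that theorem to the whole combination would not
    show. *)
Lemma countable_family I (A : I -> structure L) :
  countable [set: L] -> (forall i, inhabited (A i)) ->
  exists (J : Type) (B : J -> structure L),
    [/\ countable [set: J], forall j, inhabited (B j), forall j, countable [set: B j],
        elem_equiv (CombE A) (CombE B) & forall j, exists i, elem_equiv (B j) (A i)].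
Proof.
move=> Lc Ane.
have /dep_choice[W HW] : forall pn : sentence L * nat, exists f : 'I_pn.2 -> option I,
    count_ge A (fun Y => holds Y pn.1) pn.2 ->
    exists g : 'I_pn.2 -> I, [/\ injective g, forall k, holds (A (g k)) pn.1 & forall k, f k = Some (g k)].
  move=> [p n] /=; have [/num_ge_eqP[f [finj pf]]|nA] := pselect (count_ge A (fun Y => holds Y p) n).
    by exists (Some \o f) => _; exists f; split.
  by exists (fun=> None).
pose S := [set i | exists pn k, W pn k = Some i].
pose T := {pn : sentence L * nat & 'I_pn.2}.
have Tc : countable [set: T].
  apply: countable_sigT => [|pn]; last exact: countableP.
  have c2 : countable [set: {p : sentence L & nat}].
    by apply: countable_sigT => [|p]; [exact: countable_formula|exact: countableP].
  pose h (pn : sentence L * nat) : {p : sentence L & nat} := existT (fun=> nat) pn.1 pn.2.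
  by apply: (countable_inj (f := h)) c2 => -[p n] [p' n'] [-> ->].
have Jc : countable [set: {i | S i}].
  have /choice[h Hh] : forall j : {i | S i}, exists t : T, W (projT1 t) (projT2 t) = Some (sval j).
    by move=> [i [pn [k e]]]; exists (existT _ pn k).
  apply: (countable_inj (f := h)) Tc => j j' e; apply: sig_inj.
  by apply: Some_inj; rewrite -!Hh e.
have /dep_choice[B HB] : forall j : {i | S i}, exists N : structure L,
    [/\ inhabited N, countable [set: N] & elem_equiv N (A (sval j))].
  by move=> j; exact: Lowenheim_Skolem.
exists {i | S i}, B; split=> //.
- by move=> j; have [] := HB j.
- by move=> j; have [] := HB j.
- apply: profile_comb_equiv => //; first by move=> j; have [] := HB j.
    move=> p n /(HW (p, n))/=[g [ginj pg Wg]].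
    have Sg k : S (g k) by exists (p, n), k.
    apply/num_ge_eqP; exists (fun k => exist _ _ (Sg k)); split=> [k l [] /ginj//|k].
    have [_ _ E] := HB (exist _ _ (Sg k)); apply/(elem_equiv_holds _ E); exact: pg.
  move=> p n; apply: (num_ge_map (h := sval)) => [j|j j' _ _]; last exact: sig_inj.
  by have [_ _ E] := HB j; rewrite (elem_equiv_holds _ E).
- by move=> j; exists (sval j); have [] := HB j.
Qed.

End Families.

(** * Countable models *)

Lemma infinite_inj (X Y : Type) (f : X -> Y) :
  injective f -> infinite_set [set: X] -> infinite_set [set: Y].
Proof.
move=> finj; apply: contra_not; apply: card_le_finite.
have /card_eqPle[_ le] : (f @` [set: X] #= [set: X])%card.
  by apply: inj_card_eq => x y _ _; exact: finj.
by apply: card_le_trans le _; exact: subset_card_le.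
Qed.

Section CountableModels.
Variable L : language.
Implicit Types (I J K : Type) (X Y C : structure L).

Lemma omega_modelP (L' : language) (T : set (sentence L')) (M : structure L') :
  omega_model T M <-> [/\ models M T, countable [set: M] & infinite_set [set: M]].
Proof.
split=> [[MT Mnat]|[MT Mc Mi]]; last by split=> //; exact: eq_card_nat.
split=> //; first by rewrite (eq_countable Mnat); exact: countableP.
by rewrite (eq_finite_set Mnat); exact: infinite_nat.
Qed.

Lemma comb_infinite_index J (D : J -> structure L) :
  (forall j, inhabited (D j)) -> (forall n, num_ge (fun _ : J => True) eq n) ->
  infinite_set [set: CombE D].
Proof.
move=> Dne /num_ge_infinite; have /dep_choice[x _] : forall j, exists x : D j, True.
  by move=> j; have [x] := Dne j; exists x.
by apply: (infinite_inj (f := fun j => existT _ j (x j) : CombE D)) => j j' [].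
Qed.

Lemma comb_infinite_class J (D : J -> structure L) j :
  infinite_set [set: D j] -> infinite_set [set: CombE D].
Proof.
apply: (infinite_inj (f := fun x => existT _ j x : CombE D)) => x y.
exact: existT_inj.
Qed.

Lemma comb_equiv_pointwise J (D D' : J -> structure L) :
  (forall j, inhabited (D j)) -> (forall j, inhabited (D' j)) ->
  (forall j, elem_equiv (D j) (D' j)) -> elem_equiv (CombE D) (CombE D').
Proof.
move=> Dne D'ne DD'; apply: profile_comb_equiv => // p n;
  by apply: (num_ge_map (h := id)) => // j; rewrite (elem_equiv_holds _ (DD' j)).
Qed.

Definition replace_class J (D : J -> structure L) X C j : structure L :=
  if pselect (elem_equiv (D j) X) then C else D j.

Variant replace_class_spec J (D : J -> structure L) X C j : structure L -> Type :=
| Replaced of elem_equiv (D j) X : replace_class_spec D X C j C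
| Kept of ~ elem_equiv (D j) X : replace_class_spec D X C j (D j).

Lemma replace_classP J (D : J -> structure L) X C j :
  replace_class_spec D X C j (replace_class D X C j).
Proof. by rewrite /replace_class; case: pselect => H; constructor. Qed.

Lemma omega_model_infinite X C : omega_model (Th X) C ->
  [/\ elem_equiv X C, inhabited C, countable [set: C] & infinite_set [set: C]].
Proof.
move=> /omega_modelP[/models_elem_equiv E Cc Ci]; split=> //.
by have [x _] := infinite_setN0 Ci; exists.
Qed.

(** The model with [k] added copies of [C] has exactly [k] classes isomorphic to
    [C], so these models are pairwise non-isomorphic. *)
Lemma limit_many_models I J (A : I -> structure L) (D : J -> structure L) C n :
  countable [set: J] -> (forall j, inhabited (D j)) -> (forall j, countable [set: D j]) ->
  elem_equiv (CombE A) (CombE D) -> inhabited C -> countable [set: C] ->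
  limit_of D C -> (forall j, ~ iso (D j) C) -> I_ge (Th (CombE A)) n.
Proof.
move=> Jc Dne Dc AD Cne Cc lim nC.
pose F k := family_sum D (fun _ : 'I_k => C).
have Fne k x : inhabited (F k x) by exact: family_sum_inhabited.
have F_iso k m : k < m -> ~ iso (CombE (F m)) (CombE (F k)).
  move=> km isoF.
  have H : count_ge (F k) (fun X => iso X C) m.
    apply: (count_ge_iso_comb (Fne m) (Fne k) _ isoF) => [X Y XY XC|].
      by apply: iso_trans XC; exact: iso_sym.
    by exists inr; split=> [l|l l' ll' []]; [exact: iso_refl|exact/eqP].
  have cov x : iso (F k x) C -> exists y, List.In y [seq inr l | l <- enum 'I_k] /\ x = y.
    case: x => [j /nC//|l _]; exists (inr l); split=> //; apply/In_map; exists l; split=> //.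
    by apply/In_mem; rewrite mem_enum.
  have := cover_bound (@esym _) (@etrans _) cov H.
  by rewrite size_map size_enum_ord leqNgt km.
exists (fun k => CombE (F k)); split=> [k|k m km].
  apply/omega_modelP; split.
  - apply/models_elem_equiv; apply: (elem_equiv_trans AD).
    exact: comb_add_limits.
  - apply: countable_sigT => [|[j|l]]; [|exact: Dc|exact: Cc].
    by apply: countable_sum => //; exact: countableP.
  - apply: comb_infinite_index => // m.
    have Ctrue : holds C (fnot (FBot L 0)) by [].
    by apply: (num_ge_map (h := inl)) (lim _ Ctrue m) => // j j' _ _ [].
have [lt|lt|/val_inj e] := ltngtP k m.
- by move=> /iso_sym; exact: F_iso.
- exact: F_iso.
- by rewrite e eqxx in km.
Qed.

(** Put the same countable model [C] of Th(A i) in place of all classes of that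
    theory in a fixed countable model.  The isomorphism type of [C] can be read
    off from the result. *)
Lemma class_many_models I (A : I -> structure L) i n :
  countable [set: L] -> (forall i, inhabited (A i)) -> finitely_many_theories A ->
  I_ge (Th (A i)) n -> I_ge (Th (CombE A)) n.
Proof.
move=> Lc Ane Afin [f [fmod fiso]].
have [J [D [Jc Dne Dc AD _]]] := countable_family Lc Ane.
have [j0 Dj0] : exists j, elem_equiv (D j) (A i).
  apply/(count_ge1 D (fun Y => elem_equiv Y (A i))).
  by apply/(theory_counts (A i) 1 Ane Dne Afin AD)/count_ge1; exists i.
pose R C := replace_class D (A i) C.
have Rne C : inhabited C -> forall j, inhabited (R C j).
  by move=> Cne j; rewrite /R; case: replace_classP.
have Rj0 C : R C j0 = C by rewrite /R; case: replace_classP.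
exists (fun k => CombE (R (f k))); split=> [k|k m km isoR].
  have [E Cne Cc Ci] := omega_model_infinite (fmod k).
  apply/omega_modelP; split.
  - apply/models_elem_equiv; apply: (elem_equiv_trans AD).
    apply: comb_equiv_pointwise => // [|j]; first exact: Rne.
    rewrite /R; case: replace_classP => // Dj; exact: elem_equiv_trans Dj E.
  - by apply: countable_sigT => // j; rewrite /R; case: replace_classP.
  - by apply: (comb_infinite_class (j := j0)); rewrite Rj0.
have [Ek kne _ _] := omega_model_infinite (fmod k).
have [Em mne _ _] := omega_model_infinite (fmod m).
have [s [_ sR]] := iso_comb (Rne _ kne) (Rne _ mne) isoR.
apply: (fiso _ _ km); have := sR j0; rewrite Rj0 /R.
case: replace_classP => // nD /iso_elem_equiv kD; case: nD.
by apply: elem_equiv_sym; exact: elem_equiv_trans Ek kD.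
Qed.

(** The number I(T, omega) ignores finite models, but a finite model of a complete
    theory is its only model up to isomorphism. *)
Lemma unique_countable_model X Y :
  I_le (Th X) 1 -> countable [set: X] -> countable [set: Y] -> elem_equiv Y X -> iso Y X.
Proof.
move=> X1 Xc Yc YX; have [Yfin|Yinf] := pselect (finite_set [set: Y]).
  exact: finite_elem_equiv_iso.
have [Xfin|Xinf] := pselect (finite_set [set: X]).
  by apply/iso_sym/finite_elem_equiv_iso => //; exact: elem_equiv_sym.
apply: contrapT => nYX; apply: X1.
apply: (num_ge_extend (f := fun _ : 'I_1 => X) (x := Y)).
- exact: iso_sym.
- by move=> _; apply/omega_modelP; split=> //; exact/models_elem_equiv.
- by move=> k l; rewrite !ord1 eqxx.
- by apply/omega_modelP; split=> //; apply/models_elem_equiv; exact: elem_equiv_sym.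
- by [].
Qed.

Lemma several_models_infinite X : I_ge (Th X) 1 -> infinite_set [set: X].
Proof.
move=> [f [/(_ ord0)/omega_model_infinite[E _ _ Ci] _]] Xfin.
have [g [gbij _]] := iso_sym (finite_elem_equiv_iso Xfin E).
exact: (infinite_inj (bij_inj gbij)) Ci Xfin.
Qed.

Section FiniteBound.
Variables (I : Type) (A : I -> structure L) (m : nat) (E : 'I_m -> structure L) (K : nat).
Hypothesis Ane : forall i, inhabited (A i).
Hypothesis Afin : finitely_many_theories A.

(* Either the theory of [X] determines its countable models, or [X] is
   isomorphic to one of the [E k] and its theory occurs at most [K] times. *)
Hypothesis As : forall X i, countable [set: X] -> elem_equiv (A i) X ->
  (forall Y, countable [set: Y] -> elem_equiv Y X -> iso Y X) \/
  ((exists k, iso X (E k)) /\ ~ count_ge A (fun Y => elem_equiv Y X) K.+1).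

(** The part of the isomorphism type of a countable model that its theory does
    not determine: how often each [E k] occurs, a number between 0 and [K]. *)
Definition iso_counts J (D : J -> structure L) : {ffun 'I_m * 'I_K -> bool} :=
  [ffun kn : 'I_m * 'I_K => `[< count_ge D (fun X => iso X (E kn.1)) kn.2.+1 >]].

(** If the theory of [X] determines its countable models, the classes isomorphic
    to [X] are those of its theory, and their number depends on T only.
    Otherwise their number is recorded in [iso_counts]. *)
Lemma iso_counts_le J J' (D : J -> structure L) (D' : J' -> structure L) X n :
  (forall j, inhabited (D j)) -> (forall j, inhabited (D' j)) ->
  (forall j, countable [set: D j]) -> (forall j, countable [set: D' j]) ->
  elem_equiv (CombE A) (CombE D) -> elem_equiv (CombE A) (CombE D') ->
  iso_counts D = iso_counts D' ->
  count_ge D (fun Y => iso X Y) n -> count_ge D' (fun Y => iso X Y) n.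
Proof.
move=> Dne D'ne Dc D'c AD AD' DD'; case: n => [|n] H; first exact: num_ge0.
have /(count_ge1 D (fun Y => iso X Y))[j Xj] := num_ge_leq (ltn0Sn n) H.
have Xc : countable [set: X].
  by have [f [fbij _]] := Xj; apply: countable_inj (bij_inj fbij) (Dc j).
have [i Ai] : exists i, elem_equiv (A i) X.
  apply/(count_ge1 A (fun Y => elem_equiv Y X)).
  apply/(theory_counts X 1 Ane Dne Afin AD)/(count_ge1 D (fun Y => elem_equiv Y X)).
  by exists j; apply: elem_equiv_sym; exact: iso_elem_equiv.
have HE : count_ge D (fun Y => elem_equiv Y X) n.+1.
  by apply: count_ge_sub H => k /iso_elem_equiv/elem_equiv_sym.
have [uniqX|[[k XE] nA]] := As Xc Ai.
  have : count_ge D' (fun Y => elem_equiv Y X) n.+1.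
    by apply/(theory_counts X _ Ane D'ne Afin AD')/(theory_counts X _ Ane Dne Afin AD).
  by apply: count_ge_sub => k Dk; apply/iso_sym/uniqX.
have nK : n < K.
  rewrite ltnNge; apply/negP => Kn; apply: nA; apply: (@num_ge_leq _ _ _ _ n.+1) => //.
  exact/(theory_counts X _ Ane Dne Afin AD).
have DE : count_ge D (fun Y => iso Y (E k)) n.+1.
  by apply: count_ge_sub H => l /iso_sym XD; exact: iso_trans XD XE.
have /ffunP/(_ (k, Ordinal nK)) := DD'; rewrite !ffunE /= => e.
move: DE => /asboolP; rewrite e => /asboolP; apply: count_ge_sub => l D'E.
by apply: (iso_trans XE); exact: iso_sym.
Qed.

(** Two countable models with equal [iso_counts] are isomorphic. *)
Lemma finitely_many_models :
  I_le (Th (CombE A)) #|{ffun 'I_m * 'I_K -> bool}|.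
Proof.
move=> [f [fmod fiso]].
have pres k : exists S : {J : Type & J -> structure L},
    [/\ forall j, inhabited (projT2 S j), iso (CombE (projT2 S)) (f k),
        countable [set: projT1 S] & forall j, countable [set: projT2 S j]].
  have /omega_modelP[/models_elem_equiv Ek fc _] := fmod k.
  have [J [B [Bne Biso /(_ fc)[Jc Bc]]]] := model_presentation Ek.
  by exists (existT _ J B).
have [S HS] := choice pres.
have equiv k : elem_equiv (CombE A) (CombE (projT2 (S k))).
  have /omega_modelP[/models_elem_equiv Ek _ _] := fmod k.
  apply: (elem_equiv_trans Ek); apply/elem_equiv_sym/iso_elem_equiv.
  by have [] := HS k.
have inj : injective (fun k => iso_counts (projT2 (S k))).
  move=> k l e; apply: contrapT => /eqP/fiso; apply.
  have [kne kiso kc kcs] := HS k; have [lne liso lc lcs] := HS l.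
  have [|g [gbij giso]] := bijection_of_counts (f := projT2 (S k)) (f' := projT2 (S l))
      (@iso_refl L) (@iso_sym L) (@iso_trans L) kc lc.
    by move=> X n; split; apply: iso_counts_le.
  apply: (iso_trans (iso_sym kiso)); apply: iso_trans liso.
  exact: comb_iso giso.
by have := leq_card _ inj; rewrite card_ord ltnn.
Qed.

End FiniteBound.

Lemma family_Ehrenfeucht I (A : I -> structure L) :
  countable [set: L] -> (forall i, inhabited (A i)) -> finitely_many_theories A ->
  (forall i, I_lt_omega (Th (A i))) ->
  num_ge (fun i => I_ge (Th (A i)) 2) eq 1 -> num_lt_omega (fun i => I_ge (Th (A i)) 2) eq ->
  Ehrenfeucht (Th (CombE A)).
Proof.
move=> Lc Ane Afin ha [f [hb _]] [K hK].
split; first exact: class_many_models (hb ord0).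
have [t Ht] := bounded_cover (@esym _) (@erefl _) hK.
have /choice[E HE] : forall i, exists E : seq (structure L),
    forall C, omega_model (Th (A i)) C -> exists D, List.In D E /\ iso C D.
  by move=> i; have [n hn] := ha i; exact: bounded_cover (@iso_sym L) (@iso_refl L) hn.
have [e He] := seq_index (flatten (map E t)).
exists #|{ffun 'I_(size (flatten (map E t))) * 'I_K -> bool}|.
apply: (finitely_many_models (E := e)) => // X i Xc AX.
have [H|H] := pselect (I_ge (Th (A i)) 2); [right|left]; last first.
  by move=> Y Yc YX; apply: unique_countable_model => //; rewrite -[Th X]AX.
split.
  have [i' [i't ii']] := Ht i H.
  have [|D [DE XD]] := HE i X.
    apply/omega_modelP; split=> //; first exact/models_elem_equiv.
    by apply: several_models_infinite; rewrite -[Th X]AX; exact: num_ge_leq H.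
  have [k ek] : exists k, e k = D.
    apply: He; apply/In_flatten; exists (E i); split=> //.
    by apply/In_map; exists i; split=> //; rewrite ii'.
  by exists k; rewrite ek.
move=> AK; apply: hK; apply: (num_ge_map (h := id)) AK => // i' Ei'.
by rewrite [Th (A i')](elem_equiv_trans Ei' (elem_equiv_sym AX)).
Qed.

Lemma Ehrenfeucht_finitely_many_theories I (A : I -> structure L) :
  countable [set: L] -> (forall i, inhabited (A i)) ->
  I_lt_omega (Th (CombE A)) -> finitely_many_theories A.
Proof.
move=> Lc Ane [n nA]; apply: contrapT => Ainf; apply: nA.
have [J [B [X [Bne Xne AB lim miss]]]] := infinitely_many_theories_limit Ane Ainf.
have [J' [D [J'c Dne Dc BD DB]]] := countable_family Lc Bne.
have [C [Cne Cc CX]] := Lowenheim_Skolem Lc Xne.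
apply: limit_many_models J'c Dne Dc (elem_equiv_trans AB BD) Cne Cc _ _.
  move=> p /(elem_equiv_holds p CX)/lim H m.
  exact: comb_equiv_profile Bne BD _ _ (H m).
move=> j /iso_elem_equiv E; have [i Di] := DB j; apply: (miss i).
apply: (elem_equiv_trans (elem_equiv_sym Di)); exact: elem_equiv_trans E CX.
Qed.

(** Otherwise the indices satisfying [P] would form a finite union of finite
    sets, one for each theory. *)
Lemma infinitely_repeated_theory I (A : I -> structure L) (P : I -> Prop) :
  finitely_many_theories A -> ~ num_lt_omega P eq ->
  (forall i i', elem_equiv (A i) (A i') -> P i -> P i') ->
  exists i, P i /\ forall n, count_ge A (fun Y => elem_equiv Y (A i)) n.
Proof.
move=> /finitely_many_theories_cover[s Hs] Pinf PA; apply: contrapT => none.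
have /choice[c Hc] : forall i, exists c : seq I, P i ->
    forall i', elem_equiv (A i') (A i) -> List.In i' c.
  move=> i; have [Pi|nPi] := pselect (P i); last by exists [::].
  have [n nA] : exists n, ~ count_ge A (fun Y => elem_equiv Y (A i)) n.
    apply: contrapT => H; apply: none; exists i; split=> // n.
    by apply: contrapT => nA; apply: H; exists n.
  have [c Hc] := bounded_cover (@esym _) (@erefl _) nA.
  by exists c => _ i' /Hc[y [yc ->]].
have cov i : P i -> exists y, List.In y (flatten (map c s)) /\ i = y.
  move=> Pi; exists i; split=> //; apply/In_flatten; have [i' [i's Ei]] := Hs i.
  exists (c i'); split; first by apply/In_map; exists i'.
  by apply: Hc => //; exact: PA Ei Pi.
have := cover_bound (@esym _) (@etrans _) cov (not_num_lt_omega (size (flatten (map c s))).+1 Pinf).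
by rewrite ltnn.
Qed.

(** If no class theory had two countable models, [finitely_many_models] with an
    empty list of exceptional structures would leave at most one countable
    model.  If infinitely many classes had such theories, one theory with
    countable models [C] and [C'] would occur infinitely often, and [C] would
    be a limit of a model in which all classes of this theory are [C']. *)
Lemma Ehrenfeucht_family I (A : I -> structure L) :
  countable [set: L] -> (forall i, inhabited (A i)) -> Ehrenfeucht (Th (CombE A)) ->
  [/\ finitely_many_theories A, forall i, I_lt_omega (Th (A i)),
      num_ge (fun i => I_ge (Th (A i)) 2) eq 1 &
      num_lt_omega (fun i => I_ge (Th (A i)) 2) eq].
Proof.
move=> Lc Ane [A2 Afinm]; have Afin := Ehrenfeucht_finitely_many_theories Lc Ane Afinm.
have [n nA] := Afinm; split=> //.
- by move=> i; exists n => /(class_many_models Lc Ane Afin).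
- apply: contrapT => none.
  have E : 'I_0 -> structure L by case.
  have : I_le (Th (CombE A)) #|{ffun 'I_0 * 'I_0 -> bool}|.
    apply: (finitely_many_models (E := E)) => // X i Xc AX; left=> Y Yc YX.
    apply: unique_countable_model => //; rewrite -[Th X]AX => H2; apply: none.
    by exists (fun=> i); split=> // k l; rewrite !ord1 eqxx.
  by rewrite card_ffun card_bool card_prod !card_ord.
apply: contrapT => Pinf.
have [|i [[f [fmod fiso]] Hi]] := infinitely_repeated_theory Afin Pinf.
  by move=> i i' E; rewrite [Th (A i)]E.
have [E Cne Cc Ci] := omega_model_infinite (fmod ord0).
have [E' C'ne C'c C'i] := omega_model_infinite (fmod ord_max).
have [J [D [Jc Dne Dc AD _]]] := countable_family Lc Ane.
pose D' := replace_class D (A i) (f ord_max).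
have DD' j : elem_equiv (D j) (D' j).
  by rewrite /D'; case: replace_classP => // Dj; exact: elem_equiv_trans Dj E'.
have D'ne j : inhabited (D' j) by rewrite /D'; case: replace_classP.
apply: nA; apply: (limit_many_models (D := D') (C := f ord0)) => //.
- by move=> j; rewrite /D'; case: replace_classP.
- by apply: (elem_equiv_trans AD); exact: comb_equiv_pointwise.
- move=> p /(elem_equiv_holds p E) Ap m.
  have := (theory_counts (A i) m Ane Dne Afin AD).1 (Hi m).
  apply: (num_ge_map (h := id)) => // j Dj.
  by apply/(elem_equiv_holds _ (elem_equiv_sym (DD' j)))/(elem_equiv_holds _ Dj).
- move=> j; rewrite /D'; case: replace_classP => [_ /fiso|nD /iso_elem_equiv Dj].
    by apply.
  by apply: nD; apply: (elem_equiv_trans Dj); exact: elem_equiv_sym.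
Qed.

End CountableModels.

(** * Models of T and e-largest models *)

Section Translation.
Variables (L : language) (I : Type) (A : I -> structure L).
Hypothesis Ane : forall i, inhabited (A i).
Local Notation T := (Th (CombE A)).

Lemma model_family (M : structure (withE L)) : models M T ->
  exists (J : Type) (B : J -> structure L) (c : M -> J),
    [/\ forall j, inhabited (B j), elem_equiv (CombE A) (CombE B) & class_map B c].
Proof.
move=> /models_elem_equiv E; have [J [B [Bne Biso _]]] := model_presentation E.
have [c Hc] := iso_class_map Bne Biso.
exists J, B, c; split=> //; apply: (elem_equiv_trans E).
exact/elem_equiv_sym/iso_elem_equiv.
Qed.

Lemma class_map_count J (B : J -> structure L) (M : structure (withE L)) (c : M -> J)
    (P : M -> Prop) (Q : structure L -> Prop) n :
  class_map B c -> (forall a, P a <-> Q (B (c a))) ->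
  num_ge P (@Erel L M) n <-> count_ge B Q n.
Proof. by move=> [csurj cE _] PQ; exact: num_ge_surj csurj PQ cE. Qed.

Lemma class_map_num_lt_omega J (B : J -> structure L) (M : structure (withE L)) (c : M -> J)
    (P : M -> Prop) (Q : structure L -> Prop) :
  class_map B c -> (forall a, P a <-> Q (B (c a))) ->
  num_lt_omega P (@Erel L M) <-> num_lt_omega (fun j => Q (B j)) eq.
Proof.
by move=> Hc PQ; split=> -[n nn]; exists n => /(class_map_count n.+1 Hc PQ).
Qed.

Lemma class_map_Th J (B : J -> structure L) (M : structure (withE L)) (c : M -> J) a :
  class_map B c -> Th (eclass a) = Th (B (c a)).
Proof. by move=> [_ _ ciso]; exact: iso_elem_equiv. Qed.

Lemma class_map_fin_classes J (B : J -> structure L) (M : structure (withE L)) (c : M -> J) X :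
  class_map B c ->
  fin_classes_equiv M X <-> num_lt_omega (fun j => elem_equiv (B j) X) eq.
Proof.
move=> Hc; apply: (@class_map_num_lt_omega _ _ _ _ _ (fun Y => elem_equiv Y X) Hc) => a.
by rewrite /elem_equiv (class_map_Th a Hc).
Qed.

Lemma fin_classes_transfer (M : structure (withE L)) X :
  finitely_many_theories A -> models M T ->
  fin_classes_equiv M X <-> num_lt_omega (fun i => elem_equiv (A i) X) eq.
Proof.
move=> Afin /model_family[J [B [c [Bne AB Hc]]]].
rewrite (class_map_fin_classes X Hc).
by split=> -[n nn]; exists n => /(theory_counts X n.+1 Ane Bne Afin AB).
Qed.

Lemma every_model_e_largest (M : structure (withE L)) :
  finitely_many_theories A -> models M T -> e_largest T M.
Proof.
move=> Afin MT; split=> // N NT b.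
have [J [B [c [Bne AB Hc]]]] := model_family MT.
have [J' [B' [c' [B'ne AB' Hc']]]] := model_family NT.
have H : count_ge A (fun Y => elem_equiv Y (eclass b)) 1.
  apply/(theory_counts _ 1 Ane B'ne Afin AB').
  apply/(count_ge1 B' (fun Y => elem_equiv Y (eclass b))).
  by exists (c' b); rewrite /elem_equiv (class_map_Th b Hc').
have /(count_ge1 B (fun Y => elem_equiv Y (eclass b)))[j Bj] :=
  (theory_counts _ 1 Ane Bne Afin AB).1 H.
have [csurj _ _] := Hc; have [a aj] := csurj j; exists a.
by rewrite /elem_equiv (class_map_Th a Hc) aj.
Qed.

(** Add one model of each theory that is a limit of the [A i]: a class theory
    missing from [A] is such a limit. *)
Lemma e_largest_family :
  exists (K : Type) (G : K -> structure L),
    [/\ forall k, inhabited (G k), elem_equiv (CombE A) (CombE G) &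
        forall N, models N T -> forall b : N, exists k, elem_equiv (eclass b) (G k)].
Proof.
pose K := {t : set (sentence L) | exists X : structure L, [/\ inhabited X, Th X = t & limit_of A X]}.
have /dep_choice[D HD] : forall t : K, exists X : structure L, [/\ inhabited X, Th X = sval t & limit_of A X].
  by move=> t; exact: (svalP t).
exists (I + K)%type, (family_sum A D); split.
- by apply: family_sum_inhabited => // t; have [] := HD t.
- by apply: comb_add_limits => // t; have [] := HD t.
move=> N /model_family[J [B [c [Bne AB Hc]]]] b.
have [[i Ai]|miss] := pselect (exists i, elem_equiv (A i) (B (c b))).
  by exists (inl i); rewrite /elem_equiv (class_map_Th b Hc) -Ai.
have lim : limit_of A (B (c b)).
  by apply: (missing_class_limit Bne AB) => i Ai; apply: miss; exists i.
have tP : exists X : structure L, [/\ inhabited X, Th X = Th (B (c b)) & limit_of A X].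
  by exists (B (c b)).
pose t : K := exist _ (Th (B (c b))) tP.
by exists (inr t); rewrite /elem_equiv (class_map_Th b Hc); have [_ -> _] := HD t.
Qed.

(** With a limit [X] missing from some combination [B], the e-largest model [G'] with
    infinitely many copies of [X] violates (b) or (c), according to the number
    of countable models of Th(X). *)
Lemma conditions_finitely_many_theories :
  e_largest_cond T -> finitely_many_theories A.
Proof.
move=> cond; apply: contrapT => Ainf.
have [J [B [X [Bne Xne AB limX miss]]]] := infinitely_many_theories_limit Ane Ainf.
have [K [G [Gne AG Gall]]] := e_largest_family.
have limG : limit_of G X.
  move=> p Xp n.
  have BG := elem_equiv_trans (elem_equiv_sym AB) AG.
  exact: comb_equiv_profile Bne BG p n (limX p Xp n).
pose G' := family_sum G (fun _ : nat => X).
have G'ne k : inhabited (G' k) by exact: family_sum_inhabited.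
have AG' : elem_equiv (CombE A) (CombE G').
  by apply: (elem_equiv_trans AG); exact: comb_add_limits.
have G'T : models (CombE G') T by exact/models_elem_equiv.
have [c Hc] := iso_class_map G'ne (iso_refl (CombE G')).
have [csurj _ _] := Hc.
have G'large : e_largest T (CombE G').
  split=> // N NT b; have [k bk] := Gall N NT b; have [a ak] := csurj (inl k).
  by exists a; rewrite /elem_equiv (class_map_Th a Hc) ak.
have [_ [_ bfin] condc] := cond _ G'large.
have copies (Q : structure L -> Prop) n : Q X -> count_ge G' Q n.
  by move=> QX; exists (fun k => inr (val k)); split=> // k l /eqP kl [] /val_inj.
have [X2|X1] := pselect (I_ge (Th X) 2).
  have b2 a : I_ge (Th (eclass a)) 2 <-> I_ge (Th (G' (c a))) 2 by rewrite (class_map_Th a Hc).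
  have [n] := (class_map_num_lt_omega (Q := fun Y => I_ge (Th Y) 2) Hc b2).1 bfin.
  by apply; exact: (copies (fun Y => I_ge (Th Y) 2)).
have [a aX] := csurj (inr 0).
have aTh : Th (eclass a) = Th X by rewrite (class_map_Th a Hc) aX.
have [|H|H] := condc a; first by rewrite aTh.
  have [n] := (class_map_fin_classes (eclass a) Hc).1 (H _ G'T).
  by apply; apply: (copies (fun Y => elem_equiv Y (eclass a))).
have BT : models (CombE B) T by exact/models_elem_equiv.
apply: (H _ BT); have [d Hd] := iso_class_map Bne (iso_refl (CombE B)).
apply/(class_map_fin_classes _ Hd); exists 0 => -[f [Ef _]].
by apply: (miss (f ord0)); rewrite /elem_equiv (Ef ord0).
Qed.

End Translation.

Unset Implicit Arguments.

Theorem theorem5p1 (L : language) (I : Type) (A : I -> structure L)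
    (A_nonempty : forall i, inhabited (A i))
    (L_countable : countable [set: L])
    (AE_infinite : infinite_set [set: CombE A]) :
  let T := Th (CombE A) in
  (Ehrenfeucht T <-> eSpT_lt_omega T /\ e_largest_cond T) /\
  (Ehrenfeucht T <-> eSpT_eq0 T /\ e_largest_cond T).
Proof.
move=> T.
have necessity : Ehrenfeucht T -> eSpT_eq0 T /\ e_largest_cond T.
  move=> ET; have [Afin _ _ _] := Ehrenfeucht_family L_countable A_nonempty ET.
  split.
    move=> M MT [f [/(_ ord0)[[N [NM [b fb]]] new] _]].
    have NT : models N T.
      move/models_elem_equiv: MT => AM; apply/models_elem_equiv.
      exact: elem_equiv_trans AM (elem_equiv_sym NM).
    have [_ /(_ N NT b)[a ba]] := every_model_e_largest A_nonempty Afin MT.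
    by apply: (new a); rewrite fb.
  move=> M [MT _]; have [J [B [c [Bne AB Hc]]]] := model_family MT.
  have EB : Ehrenfeucht (Th (CombE B)) by rewrite -[Th (CombE B)]AB.
  have [_ ha hb1 hb2] := Ehrenfeucht_family L_countable Bne EB.
  have b2 a : I_ge (Th (eclass a)) 2 <-> I_ge (Th (B (c a))) 2 by rewrite (class_map_Th a Hc).
  split.
  - by move=> a; rewrite (class_map_Th a Hc).
  - split; first exact/(class_map_count (Q := fun Y => I_ge (Th Y) 2) 1 Hc b2).
    exact/(class_map_num_lt_omega (Q := fun Y => I_ge (Th Y) 2) Hc b2).
  - move=> a _; have [H|H] := pselect (num_lt_omega (fun i => elem_equiv (A i) (eclass a)) eq).
      by left=> N NT; exact/(fin_classes_transfer A_nonempty _ Afin NT).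
    by right=> N NT /(fin_classes_transfer A_nonempty _ Afin NT).
have sufficiency : e_largest_cond T -> Ehrenfeucht T.
  move=> cond; have Afin := conditions_finitely_many_theories A_nonempty cond.
  have AT : models (CombE A) T by exact/models_elem_equiv.
  have [ca [cb1 cb2] _] := cond _ (every_model_e_largest A_nonempty Afin AT).
  have [c Hc] := iso_class_map A_nonempty (iso_refl (CombE A)).
  have b2 a : I_ge (Th (eclass a)) 2 <-> I_ge (Th (A (c a))) 2 by rewrite (class_map_Th a Hc).
  apply: family_Ehrenfeucht => //.
  - move=> i; have [csurj _ _] := Hc; have [a <-] := csurj i.
    by rewrite -(class_map_Th a Hc).
  - exact/(class_map_count (Q := fun Y => I_ge (Th Y) 2) 1 Hc b2).
  - exact/(class_map_num_lt_omega (Q := fun Y => I_ge (Th Y) 2) Hc b2).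
split; split=> [/necessity[e0 cond]|[_ /sufficiency//]]; last by split.
by split=> //; exists 0.
Qed.
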